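(* Let $1<\alpha<2$ and $\gamma>0$. The identity map on $\mathcal{P}^{\cos}$ extends uniquely to an isomorphism (bounded linear bijection with bounded inverse) between the half-period cosine space $H_{\alpha,\gamma,1}^{\cos}$ and the fractional Sobolev-type space $H_{\alpha,\gamma,1}^{\mathrm{sob}}$. Thus, after this canonical identification, the two spaces coincide as sets, and their norms are equivalent with constants independent of $\gamma$ and $f$; that is, there are constants $0<c\le C<\infty$, independent of $\gamma$ and $f$, such that $c\,\|f\|_{\alpha,\gamma,1}^{\cos}\le \|f\|_{\alpha,\gamma,1}^{\mathrm{sob}}\le C\,\|f\|_{\alpha,\gamma,1}^{\cos}$ for all $f$ in this common space.
   Context: All functions are real-valued on $[0,1]$. Let $\phi_0(x)=1$ and $\phi_k(x)=\sqrt{2}\cos(k\pi x)$ for $k\in\mathbb{N}=\{1,2,\ldots\}$; $\{\phi_k\}_{k\ge 0}$ is an orthonormal basis of $L_2([0,1])$. For $f\in L_2([0,1])$ put $\widetilde f(k)=\int_0^1 f(x)\phi_k(x)\,dx$. Half-period cosine space: for $\alpha>1/2$, $\gamma>0$, $H_{\alpha,\gamma,1}^{\cos}$ is the Hilbert space of all $f\in L_2([0,1])$ with finite norm given by $$(\|f\|_{\alpha,\gamma,1}^{\cos})^2=|\widetilde f(0)|^2+\frac{1}{\gamma^2}\sum_{k=1}^\infty k^{2\alpha}|\widetilde f(k)|^2 .$$ Let $\mathcal{P}^{\cos}=\operatorname{span}\{\phi_k\mid k\in\mathbb{N}_0\}$ (finite linear combinations). For $1<\alpha<2$ and $f,g\in\mathcal{P}^{\cos}$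 define $$\mathcal{B}_\alpha(f',g')=\frac{(\alpha-1)(2-\alpha)\pi^3}{8}\int_0^1\!\int_0^1\left(\frac{(f'(x)-f'(y))(g'(x)-g'(y))}{\left|\sin\left(\frac{\pi(x-y)}{2}\right)\right|^{2\alpha-1}}+\frac{(f'(x)+f'(y))(g'(x)+g'(y))}{\left|\sin\left(\frac{\pi(x+y)}{2}\right)\right|^{2\alpha-1}}\right)dx\,dy,$$ $$\langle f,g\rangle_{\alpha,\gamma,1}^{\mathrm{sob}}=\int_0^1 f(x)\,dx\int_0^1 g(x)\,dx+\frac{1}{\gamma^2}\left(\int_0^1 f'(x)g'(x)\,dx+\mathcal{B}_\alpha(f',g')\right).$$ $H_{\alpha,\gamma,1}^{\mathrm{sob}}$ is the completion of $\mathcal{P}^{\cos}$ with respect to the norm $\|\cdot\|_{\alpha,\gamma,1}^{\mathrm{sob}}$ induced by this inner product. *)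

(* Defs.v *)
From HB Require Import structures.
From mathcomp Require Import all_boot all_order all_algebra.
From mathcomp Require Import all_classical all_reals all_analysis measurable_realfun ring.
Set Implicit Arguments.
Unset Strict Implicit.
Unset Printing Implicit Defensive.
Import Order.TTheory GRing.Theory Num.Theory.
Import numFieldNormedType.Exports.
Local Open Scope classical_set_scope.
Local Open Scope ring_scope.

(* L_2([0, 1]) is rendered as the L_2 space over R of Lebesgue measure
   restricted to [0, 1]. *)
Definition unit_measure (R : realType) :
    {measure set (measurableTypeR R) -> \bar R} :=
  mrestr (@lebesgue_measure R) (measurable_itv `[0, 1]).

Definition L2 (R : realType) := LspaceType (unit_measure R) (lee1n 2).

(* [LspaceType] consists of a.e.-classes and comes without algebraic structure;
   the operations below are those induced by pointwise ones on
   representatives. *)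
Section L2_lmodule.
Variable R : realType.
Local Notation mu := (unit_measure R).
Local Notation fun2 := (LfunType mu (lee1n 2)).
Implicit Types (f g h : L2 R) (u v : fun2).

HB.instance Definition _ := gen_eqMixin (L2 R).
HB.instance Definition _ := gen_choiceMixin (L2 R).

Lemma L2_eqP f g : f = g <-> (f : R -> R) = g %[ae mu].
Proof.
split=> [->|fg]; first exact: ae_eq_refl.
have : LebesgueSpace.sort f = LebesgueSpace.sort g.
  rewrite -[LHS]reprK -[RHS]reprK; apply/eqmodP/asboolP; exact: fg.
case: f g {fg} => f [[cf]] [g [[cg]]] /= fg; rewrite {}fg in cf *.
by rewrite (Prop_irrelevance cf cg).
Qed.

Definition to_mfun (u : fun2) : {mfun measurableTypeR R >-> measurableTypeR R} :=
  HB.pack_for {mfun measurableTypeR R >-> measurableTypeR R}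
    (u : measurableTypeR R -> measurableTypeR R)
    (isMeasurableFun.Build _ _ (measurableTypeR R) (measurableTypeR R) u
      (@measurable_funPT _ _ _ _ u)).

Lemma to_mfunK u : (repr (\pi_{mfun_ mu, _ >-> measurableTypeR R} (to_mfun u))%qT : R -> R) = u %[ae mu].
Proof.
have /eqmodP/asboolP := reprK (\pi_{mfun_ mu, _ >-> measurableTypeR R} (to_mfun u))%qT.
exact.
Qed.

Lemma finite_norm_ae (f g : R -> R) : measurable_fun setT f -> measurable_fun setT g ->
  f = g %[ae mu] -> finite_norm mu 2 f -> finite_norm mu 2 g.
Proof.
move=> mf mg fg; rewrite /finite_norm unlock.
suff -> : (\int[mu]_x `|(EFin \o f) x| `^ 2 = \int[mu]_x `|(EFin \o g) x| `^ 2)%E by [].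
apply: ge0_ae_eq_integral => //.
- apply/measurable_EFinP; apply: (@measurableT_comp _ _ _ _ _ _ (@powR R ^~ 2)) => //.
  exact: measurableT_comp.
- apply/measurable_EFinP; apply: (@measurableT_comp _ _ _ _ _ _ (@powR R ^~ 2)) => //.
  exact: measurableT_comp.
- by move=> x _; exact: poweR_ge0.
- by move=> x _; exact: poweR_ge0.
- exact: (ae_eq_comp (fun r : R => (`|r%:E| `^ 2)%E) fg).
Qed.

Lemma L2_class_subproof u :
  finite_norm mu 2 (repr (\pi_{mfun_ mu, _ >-> measurableTypeR R} (to_mfun u))%qT : R -> R).
Proof.
apply: (@finite_norm_ae u); last exact: Lfunction_finite.
- exact: (@measurable_funPT _ _ _ _ u).
- exact: (@measurable_funPT _ _ (measurableTypeR R) (measurableTypeR R) (repr _)).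
- exact/ae_eq_sym/to_mfunK.
Qed.

Definition L2_class u : L2 R :=
  LebesgueSpace.Pack (LebesgueSpace.Class (isFinLebesgue.Build _ _ _ _ _ (lee1n 2) _ (L2_class_subproof u))).

Lemma L2_classE u : (L2_class u : R -> R) = u %[ae mu].
Proof. exact: to_mfunK. Qed.

Lemma L2_Lfun f : (f : R -> R) \in Lfun mu 2.
Proof.
apply/andP; split; rewrite inE /=.
  exact: (@measurable_funPT _ _ (measurableTypeR R) (measurableTypeR R) (repr (LebesgueSpace.sort f))).
exact: (@Lebesgue_finite _ _ _ mu 2 (lee1n 2) f).
Qed.

Definition L2_fun f : fun2 := Lfun_Sub (lee1n 2) (L2_Lfun f).

Lemma L2_funE f : (L2_fun f : R -> R) = f.
Proof. by []. Qed.

Lemma L2_class_eq u v : (u : R -> R) = v %[ae mu] -> L2_class u = L2_class v.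
Proof.
move=> uv; apply/L2_eqP; apply: ae_eq_trans (L2_classE u) _.
by apply: ae_eq_trans uv _; exact/ae_eq_sym/L2_classE.
Qed.

Lemma L2_funK f : L2_class (L2_fun f) = f.
Proof. by apply/L2_eqP; exact: L2_classE. Qed.

Lemma L2_classP f : exists u, f = L2_class u.
Proof. by exists (L2_fun f); rewrite L2_funK. Qed.

Definition L2_add f g := L2_class (L2_fun f + L2_fun g).
Definition L2_opp f := L2_class (- L2_fun f).
Definition L2_scale (a : R) f := L2_class (a *: L2_fun f).

Lemma L2_addE u v : L2_add (L2_class u) (L2_class v) = L2_class (u + v).
Proof.
apply: L2_class_eq.
exact: (@comp_ae_eq2' _ _ _ mu setT R R R +%R _ _ (L2_classE u) _ _ (L2_classE v)).
Qed.

Lemma L2_oppE u : L2_opp (L2_class u) = L2_class (- u).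
Proof. by apply: L2_class_eq; exact: (ae_eq_comp -%R (L2_classE u)). Qed.

Lemma L2_scaleE a u : L2_scale a (L2_class u) = L2_class (a *: u).
Proof. by apply: L2_class_eq; exact: (ae_eq_comp ( *%R a) (L2_classE u)). Qed.

Lemma L2_addA : associative L2_add.
Proof.
move=> f g h; have [u ->] := L2_classP f; have [v ->] := L2_classP g.
have [w ->] := L2_classP h.
by rewrite !L2_addE addrA.
Qed.

Lemma L2_addC : commutative L2_add.
Proof. by move=> f g; rewrite /L2_add addrC. Qed.

Lemma L2_add0 : left_id (L2_class 0) L2_add.
Proof. by move=> f; have [u ->] := L2_classP f; rewrite L2_addE add0r. Qed.

Lemma L2_addN : left_inverse (L2_class 0) L2_opp L2_add.
Proof. by move=> f; have [u ->] := L2_classP f; rewrite L2_oppE L2_addE addNr. Qed.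

HB.instance Definition _ :=
  GRing.isZmodule.Build (L2 R) L2_addA L2_addC L2_add0 L2_addN.

Lemma L2_classD u v : L2_class u + L2_class v = L2_class (u + v).
Proof. exact: L2_addE. Qed.

Lemma L2_scaleA a b f : L2_scale a (L2_scale b f) = L2_scale (a * b) f.
Proof. by have [u ->] := L2_classP f; rewrite !L2_scaleE scalerA. Qed.

Lemma L2_scale1 : left_id 1 L2_scale.
Proof. by move=> f; have [u ->] := L2_classP f; rewrite L2_scaleE scale1r. Qed.

Lemma L2_scaleDr : right_distributive L2_scale +%R.
Proof.
move=> a f g; have [u ->] := L2_classP f; have [v ->] := L2_classP g.
by rewrite L2_classD !L2_scaleE L2_classD scalerDr.
Qed.

Lemma L2_scaleDl f : {morph L2_scale^~ f : a b / a + b}.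
Proof.
move=> a b; have [u ->] := L2_classP f.
by rewrite !L2_scaleE L2_classD scalerDl.
Qed.

HB.instance Definition _ := GRing.Zmodule_isLmodule.Build R (L2 R)
  L2_scaleA L2_scale1 L2_scaleDr L2_scaleDl.

Lemma L2_linE a f g :
  ((a *: f + g : L2 R) : R -> R) = (fun x => a * f x + g x) %[ae mu].
Proof.
apply: ae_eq_trans (L2_classE _) _.
exact: (@comp_ae_eq2' _ _ _ mu setT R R R +%R _ _ (L2_classE _) _ _ (ae_eq_refl _ _ _)).
Qed.

End L2_lmodule.

Section cosine_basis.
Variable R : realType.

Definition cos_basis (k : nat) (x : R) : R :=
  if k == 0 then 1 else Num.sqrt 2 * cos (k%:R * pi * x).

Definition cos_coef (f : R -> R) (k : nat) : R :=
  \int[lebesgue_measure]_(x in `[0, 1]) (f x * cos_basis k x).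

(* Members of the span are taken on all of [R], so that [f^`()] is their
   derivative on [0, 1], endpoints included. *)
Definition cos_polys : set (R -> R) :=
  [set p | exists n (c : nat -> R), p = fun x => \sum_(k < n) c k * cos_basis k x].

Definition cosine_normsq (alpha gamma : R) (f : R -> R) : \bar R :=
  ((cos_coef f 0 ^+ 2)%:E + (gamma ^- 2)%:E *
    \sum_(1 <= k <oo) (k%:R `^ (2 * alpha) * cos_coef f k ^+ 2)%:E)%E.

Definition cosine_norm (alpha gamma : R) (f : R -> R) : R :=
  Num.sqrt (fine (cosine_normsq alpha gamma f)).

End cosine_basis.

Section cosine_space.
Variable R : realType.
Local Notation mu := (unit_measure R).

Lemma Rintegral01E (h : R -> R) : measurable_fun setT h ->
  \int[lebesgue_measure]_(x in `[0, 1]) h x = \int[mu]_x h x.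
Proof.
move=> mh; congr fine.
have m01 : measurable (`[0, 1]%classic : set (measurableTypeR R)) by exact: measurable_itv.
rewrite (@eq_measure_integral _ _ _ _ mu); last first.
  by move=> A mA A01; rewrite /unit_measure/= /mrestr setIidl.
rewrite integral_mkcond; apply: ae_eq_integral => //.
- apply/(measurable_restrictT _ m01).
  by apply: measurable_funTS; exact/measurable_EFinP.
- exact/measurable_EFinP.
- exists (~` `[0, 1]%classic); split.
  + exact: measurableC.
  + by rewrite /unit_measure/= /mrestr setICl measure0.
  + by move=> x /= nh x01; apply: nh => _; rewrite patchE mem_set.
Qed.

Lemma measurable_cos_basis k : measurable_fun setT (@cos_basis R k).
Proof.
rewrite /cos_basis; case: (k == 0) => //.
apply: measurable_funM => //; apply: measurableT_comp.
  by apply: continuous_measurable_fun; exact: continuous_cos.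
exact: measurable_funM.
Qed.

Lemma cos_basis_bounded k x : `|@cos_basis R k x| <= 2.
Proof.
rewrite /cos_basis; case: (k == 0); first by rewrite normr1 ler1n.
rewrite normrM ger0_norm ?sqrtr_ge0// -[leRHS]mulr1 ler_pM ?sqrtr_ge0//.
- have : Num.sqrt 2 <= Num.sqrt (2 ^+ 2) :> R.
    by rewrite ler_wsqrtr// expr2 ler_peMr ?ler1n.
  by rewrite sqrtr_sqr ger0_norm.
- by rewrite ler_norml cos_geN1 cos_le1.
Qed.

Lemma unit_measureT : mu setT = 1%E.
Proof.
rewrite /unit_measure/= /mrestr setTI lebesgue_measure_itv/= lte_fin ltr01.
by rewrite sube0.
Qed.

Lemma integrable_cos (f : L2 R) k :
  mu.-integrable setT (EFin \o (fun x => f x * cos_basis k x)).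
Proof.
have mf : measurable_fun setT (f : R -> R).
  exact: (@measurable_funPT _ _ (measurableTypeR R) (measurableTypeR R)
    (repr (LebesgueSpace.sort f))).
have fi : mu.-integrable setT (EFin \o (fun x => 2 * f x)).
  rewrite (_ : _ \o _ = (fun x => 2%:E * (EFin \o (f : R -> R)) x)%E); last first.
    by apply/funext => x /=; rewrite EFinM.
  apply: integrableZl => //; apply/Lfun1_integrable; apply: Lfun_subset12.
    by rewrite unit_measureT.
  exact: L2_Lfun.
apply: le_integrable fi => //.
- apply/measurable_EFinP; apply: measurable_funM => //.
  exact: measurable_cos_basis.
- move=> x _; rewrite lee_fin !normrM mulrC ler_wpM2r//.
  by rewrite (ger0_norm (ler0n _ 2)) cos_basis_bounded.
Qed.

Lemma cos_coef_linear (a : R) (f g : L2 R) k :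
  cos_coef (a *: f + g : L2 R) k = a * cos_coef f k + cos_coef g k.
Proof.
have mL (h : L2 R) : measurable_fun setT (fun x => h x * cos_basis k x).
  by have /measurable_EFinP := measurable_int _ (integrable_cos h k).
rewrite /cos_coef !Rintegral01E; [|exact: mL..].
rewrite -(RintegralZl a measurableT (integrable_cos f k)) -RintegralD//; last 2 first.
- have := integrableZl measurableT a (integrable_cos f k).
  by congr (_.-integrable _ _); apply/funext => x /=; rewrite EFinM.
- exact: integrable_cos.
congr fine; apply: ae_eq_integral => //.
- by apply/measurable_EFinP; exact: mL.
- by apply/measurable_EFinP; apply: measurable_funD => //; exact: measurable_funM.
- have := @ae_eq_comp2 _ _ R mu setT R (\bar R)
    (fun x y => (y * cos_basis k x)%:E) _ _ (L2_linE a f g).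
  congr ae_eq; apply/funext => x /=.
  by rewrite mulrDl mulrA.
Qed.

Variables alpha gamma : R.

Definition cosine_space_pred : {pred L2 R} :=
  fun f => (cosine_normsq alpha gamma f < +oo)%E.

Lemma cosine_space_submod_closed : submod_closed cosine_space_pred.
Proof.
have c0 k : cos_coef (0 : L2 R) k = 0.
  have := cos_coef_linear (-1) 0 0 k.
  by rewrite scaler0 addr0 mulN1r addNr.
split=> [|a f g].
  rewrite unfold_in /cosine_normsq c0 expr0n/= add0e eseries0 ?mule0// => k _ _.
  by rewrite c0 expr0n mulr0.
rewrite !unfold_in => Hf Hg.
have [s [t [s0 t0 sqst]]] : exists s t : R, [/\ 0 <= s, 0 <= t &
    forall x y, (a * x + y) ^+ 2 <= s * x ^+ 2 + t * y ^+ 2].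
  exists (2 * a ^+ 2), 2; split=> // [|x y]; first by rewrite mulr_ge0 ?sqr_ge0.
  rewrite -subr_ge0 (_ : _ - _ = (a * x - y) ^+ 2) ?sqr_ge0//; ring.
have u0 (h : R -> R) k : (0 <= (k%:R `^ (2 * alpha) * cos_coef h k ^+ 2)%:E)%E.
  by rewrite lee_fin mulr_ge0 ?powR_ge0 ?sqr_ge0.
have U0 (h : R -> R) :
    (0 <= \sum_(1 <= k <oo) (k%:R `^ (2 * alpha) * cos_coef h k ^+ 2)%:E)%E.
  by apply: nneseries_ge0 => k _ _; exact: u0.
have g0 : (0 <= (gamma ^- 2)%:E)%E by rewrite lee_fin invr_ge0 sqr_ge0.
have N0 (h : R -> R) : (0 <= cosine_normsq alpha gamma h)%E.
  by rewrite /cosine_normsq adde_ge0 ?mule_ge0// lee_fin sqr_ge0.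
apply: (@le_lt_trans _ _
    (s%:E * cosine_normsq alpha gamma f + t%:E * cosine_normsq alpha gamma g)%E); last first.
  by rewrite lte_add_pinfty// lte_mul_pinfty ?lee_fin.
rewrite /cosine_normsq !ge0_muleDr ?mule_ge0 ?lee_fin ?sqr_ge0//.
rewrite addeACA leeD//; first by rewrite -!EFinM -EFinD lee_fin cos_coef_linear.
rewrite ![(_%:E * ((gamma ^- 2)%:E * _))%E]muleCA -ge0_muleDr ?mule_ge0 ?lee_fin//.
rewrite lee_wpmul2l//.
rewrite -!nneseriesZl//; try by move=> k _; exact: u0.
rewrite -nneseriesD; try by move=> k _ _; rewrite mule_ge0 ?u0 ?lee_fin.
apply: lee_nneseries => [k _ _|k _]; first exact: u0.
rewrite -!EFinM -EFinD lee_fin cos_coef_linear [s * _]mulrCA [t * _]mulrCA -mulrDr.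
by rewrite ler_wpM2l ?powR_ge0.
Qed.

HB.instance Definition _ :=
  GRing.isSubmodClosed.Build R (L2 R) cosine_space_pred cosine_space_submod_closed.

Record cosine_space := CosineSpace {
  cosine_space_val : L2 R;
  _ : cosine_space_val \in cosine_space_pred }.

Definition cosine_space_fun (f : cosine_space) : R -> R := cosine_space_val f.
Coercion cosine_space_fun : cosine_space >-> Funclass.

HB.instance Definition _ := [isSub for cosine_space_val].
HB.instance Definition _ := [Choice of cosine_space by <:].
HB.instance Definition _ := [SubChoice_isSubLmodule of cosine_space by <:].

End cosine_space.

Section sobolev_form.
Variable R : realType.
Local Notation leb := (@lebesgue_measure R).

(* The kernel is only singular on a null set, where division by zero
   yields zero. *)
Definition frac_form (alpha : R) (u v : R -> R) : R :=
  (alpha - 1) * (2 - alpha) * pi ^+ 3 / 8 *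
  \int[(leb \x leb)%E]_(z in `[0, 1] `*` `[0, 1])
    ((u z.1 - u z.2) * (v z.1 - v z.2)
       / `|sin (pi * (z.1 - z.2) / 2)| `^ (2 * alpha - 1) +
     (u z.1 + u z.2) * (v z.1 + v z.2)
       / `|sin (pi * (z.1 + z.2) / 2)| `^ (2 * alpha - 1)).

Definition sob_inner (alpha gamma : R) (f g : R -> R) : R :=
  (\int[leb]_(x in `[0, 1]) f x) * (\int[leb]_(x in `[0, 1]) g x) +
  gamma ^- 2 * (\int[leb]_(x in `[0, 1]) (f^`()%classic x * g^`()%classic x) +
                frac_form alpha f^`()%classic g^`()%classic).

Definition sob_norm (alpha gamma : R) (f : R -> R) : R :=
  Num.sqrt (sob_inner alpha gamma f f).

End sobolev_form.

(* [j] exhibits the Banach space [E] as the completion of the function space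
   [P] under the norm [N]; its values outside [P] are irrelevant. *)
Definition is_completion (R : realType) (P : set (R -> R)) (N : (R -> R) -> R)
    (E : completeNormedModType R) (j : (R -> R) -> E) : Prop :=
  [/\ forall a f g, P f -> P g -> j (fun x => a * f x + g x) = a *: j f + j g,
      forall f, P f -> `|j f| = N f
    & dense (j @` P)].

Section isomorphism.
Variables (R : realType) (alpha gamma : R) (E : completeNormedModType R).
Local Notation H := (cosine_space alpha gamma).

Definition is_isomorphism (T : H -> E) : Prop :=
  linear T /\
  exists S : E -> H,
    [/\ cancel T S, cancel S T,
        exists M, forall f : H, `|T f| <= M * cosine_norm alpha gamma f
      & exists M, forall e : E, cosine_norm alpha gamma (S e) <= M * `|e|].

(* Elements of [cosine_space] are classes modulo equality a.e. on [0, 1]. *)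
Definition extends_identity (j : (R -> R) -> E) (T : H -> E) : Prop :=
  forall p, cos_polys p ->
    exists2 f : H, (f : R -> R) = p %[ae unit_measure R] & T f = j p.

End isomorphism.

(* Main.v *)
(* On the span of the phi_k both squared norms are diagonal in the cosine
   coefficients.  For f' = sum_k b_k sin(k pi x), which is odd and 2-periodic,
   the two singular kernels on [0,1]^2 fold into a single kernel in h = y - x,
   and orthogonality gives B_alpha(f', f') = K sum_k b_k^2 J_k with
   J_k = int_0^1 (2 - 2 cos(k pi h)) |sin(pi h/2)|^(1 - 2 alpha) dh.
   Splitting at h = 1/k shows that J_k is comparable to k^(2 alpha - 2), so the
   k-th eigenvalue of the Sobolev form is comparable to k^(2 alpha).
   Weighting the coefficients by the square roots of these eigenvalues maps the
   cosine space bijectively onto l^2: it is injective because the cosine system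
   is complete, and surjective because alpha > 1 makes the cosine series of an
   l^2 sequence absolutely convergent.  Hence l^2 is a completion of the span for
   the Sobolev norm, and any other completion is isometric to it. *)
Require Import Defs.
From HB Require Import structures.
From mathcomp Require Import all_boot all_order all_algebra.
From mathcomp Require Import all_classical all_reals all_analysis measurable_realfun ring lra.
Import Order.TTheory GRing.Theory Num.Theory.
Import numFieldNormedType.Exports.
Local Open Scope classical_set_scope.
Local Open Scope ring_scope.

(** * The Hilbert space of square-summable sequences *)

(** The target space is an arbitrary Banach space known only through [is_completion], so everything
    is computed in one concrete model, [ell2], and then transported along the relation of having a
    common approximating sequence in the span. Nothing says in advance that the singular double
    integral is finite, and [Rintegral] would hide an infinite value; the diagonalization is
    therefore an identity in [\bar R] between nonnegative quantities, where Tonelli suffices, and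
    finiteness enters only with the upper bound on the symbol. With s = 2 alpha - 1, the two ends of
    the range 1 < s < 3 are what the two pieces of that bound use: s < 3 makes h^(2 - s) integrable
    at 0, and s > 1 makes the integral of h^(-s) over [1/k, 1] of order k^(s - 1). The constants do
    not see gamma because both families of weights carry the same factor gamma^-1 for k > 0 and both
    equal 1 at k = 0. *)

Section square_summable.
Variable R : realType.
Implicit Types (a b : nat -> R) (n : nat).

Definition sqsum a n : R := \sum_(k < n) a k ^+ 2.

Lemma sqsum_ge0 a n : 0 <= sqsum a n.
Proof. by apply: sumr_ge0 => k _; exact: sqr_ge0. Qed.

Lemma sqsum_le a m n : (m <= n)%N -> sqsum a m <= sqsum a n.
Proof.
move=> /subnKC <-; elim: (n - m)%N => [|d IH]; first by rewrite addn0.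
by rewrite addnS /sqsum big_ord_recr/= ler_wpDr ?sqr_ge0.
Qed.

(** Cauchy-Schwarz in the plane follows from Lagrange's identity, whose remainder is (x v - y u)^2;
    squaring the triangle inequality then reduces it to that. *)
Lemma minkowski2 (x y u v : R) : Num.sqrt ((x + u) ^+ 2 + (y + v) ^+ 2) <=
  Num.sqrt (x ^+ 2 + y ^+ 2) + Num.sqrt (u ^+ 2 + v ^+ 2).
Proof.
set P := Num.sqrt (x ^+ 2 + _); set Q := Num.sqrt (u ^+ 2 + _).
have P2 : P ^+ 2 = x ^+ 2 + y ^+ 2 by rewrite sqr_sqrtr ?addr_ge0 ?sqr_ge0.
have Q2 : Q ^+ 2 = u ^+ 2 + v ^+ 2 by rewrite sqr_sqrtr ?addr_ge0 ?sqr_ge0.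
have PQ0 : 0 <= P * Q by rewrite mulr_ge0 ?sqrtr_ge0.
have PQ : x * u + y * v <= P * Q.
  have [h|h] := leP (x * u + y * v) 0; first exact: le_trans PQ0.
  have h0 := ltW h; rewrite -ler_sqr ?nnegrE// exprMn P2 Q2 -subr_ge0.
  rewrite (_ : _ - _ = (x * v - y * u) ^+ 2); first exact: sqr_ge0.
  by ring.
rewrite -[leRHS]ger0_norm ?addr_ge0 ?sqrtr_ge0// -sqrtr_sqr ler_wsqrtr//.
rewrite (sqrrD P Q) P2 Q2 -subr_ge0.
rewrite (_ : _ - _ = (P * Q - (x * u + y * v)) *+ 2) ?mulrn_wge0 ?subr_ge0//.
by ring.
Qed.

(** The norm of n + 1 coordinates is the planar norm of the pair made of the norm of the first n and
    the last coordinate, so [minkowski2] drives the induction. *)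
Lemma sqsumD a b n : Num.sqrt (sqsum (a + b) n) <=
  Num.sqrt (sqsum a n) + Num.sqrt (sqsum b n).
Proof.
elim: n => [|n IH]; first by rewrite /sqsum !big_ord0 sqrtr0 addr0.
have E c : sqsum c n.+1 = Num.sqrt (sqsum c n) ^+ 2 + c n ^+ 2.
  by rewrite /sqsum big_ord_recr sqr_sqrtr//; exact: sqsum_ge0.
rewrite !E; apply: le_trans (minkowski2 _ _ _ _).
by rewrite ler_wsqrtr// lerD2r ler_sqr ?nnegrE ?addr_ge0 ?sqrtr_ge0.
Qed.

Lemma sqsumZ t a n : sqsum (t *: a) n = t ^+ 2 * sqsum a n.
Proof. by rewrite /sqsum mulr_sumr; apply: eq_bigr => k _; rewrite -exprMn. Qed.

Definition sqsummable : {pred nat -> R} :=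
  fun a => `[< exists M, forall n, Num.sqrt (sqsum a n) <= M >].

Lemma sqsummableP a :
  reflect (exists M, forall n, Num.sqrt (sqsum a n) <= M) (a \in sqsummable).
Proof. exact: asboolP. Qed.

Lemma sqsummable_submod_closed : submod_closed sqsummable.
Proof.
split=> [|t a b /sqsummableP[M aM] /sqsummableP[N bN]].
  apply/sqsummableP; exists 0 => n; rewrite /sqsum big1 ?sqrtr0// => k _.
  by rewrite expr0n.
apply/sqsummableP; exists (`|t| * M + N) => n.
apply: le_trans (sqsumD _ _ _) _; rewrite lerD// sqsumZ sqrtrM ?sqr_ge0//.
by rewrite sqrtr_sqr ler_wpM2l.
Qed.

HB.instance Definition _ :=
  GRing.isSubmodClosed.Build R (nat -> R) sqsummable sqsummable_submod_closed.

Record ell2 := Ell2 { ell2_seq : nat -> R; _ : ell2_seq \in sqsummable }.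

HB.instance Definition _ := [isSub for ell2_seq].
HB.instance Definition _ := [Choice of ell2 by <:].
HB.instance Definition _ := [SubChoice_isSubLmodule of ell2 by <:].

(** A supremum of finite norms rather than a series: each inequality for finite sums passes to it
    directly. *)
Definition ell2_norm (a : ell2) : R :=
  sup (range (fun n => Num.sqrt (sqsum (val a) n))).

Lemma ell2_norm_ub (a : ell2) n : Num.sqrt (sqsum (val a) n) <= ell2_norm a.
Proof.
apply: ub_le_sup; last by exists n.
by have /sqsummableP[M aM] := valP a; exists M => _ [m _ <-].
Qed.

Lemma ell2_norm_le (a : ell2) M :
  (forall n, Num.sqrt (sqsum (val a) n) <= M) -> ell2_norm a <= M.
Proof.
move=> aM; apply: ge_sup; first by exists (Num.sqrt (sqsum (val a) 0)); exists 0.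
by move=> _ [n _ <-].
Qed.

Lemma ell2_norm_coord (a : ell2) k : `|val a k| <= ell2_norm a.
Proof.
apply: le_trans (ell2_norm_ub a k.+1); rewrite -sqrtr_sqr ler_wsqrtr//.
by rewrite /sqsum big_ord_recr/= ler_wpDl//; exact: sqsum_ge0.
Qed.

Lemma ell2_normD (a b : ell2) : ell2_norm (a + b) <= ell2_norm a + ell2_norm b.
Proof.
apply: ell2_norm_le => n; apply: le_trans (sqsumD _ _ _) _.
by rewrite lerD ?ell2_norm_ub.
Qed.

Lemma ell2_norm_ge0 (a : ell2) : 0 <= ell2_norm a.
Proof. by apply: le_trans (ell2_norm_ub a 0); exact: sqrtr_ge0. Qed.

Lemma ell2_normZ t (a : ell2) : ell2_norm (t *: a) = `|t| * ell2_norm a.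
Proof.
have le s (b : ell2) : ell2_norm (s *: b) <= `|s| * ell2_norm b.
  apply: ell2_norm_le => n.
  rewrite [val _](_ : _ = s *: val b)// sqsumZ sqrtrM ?sqr_ge0// sqrtr_sqr.
  by rewrite ler_wpM2l ?ell2_norm_ub.
apply/eqP; rewrite eq_le le/=; have [->|t0] := eqVneq t 0.
  by rewrite normr0 mul0r ell2_norm_ge0.
(* The reverse inequality is [le] for the factor t^-1 applied to [t *: a]. *)
rewrite -ler_pdivlMl ?normr_gt0//.
by rewrite -[in leLHS](scale1r a) -(mulVf t0) -scalerA -normfV le.
Qed.

Lemma ell2_norm0_eq0 (a : ell2) : ell2_norm a = 0 -> a = 0.
Proof.
move=> a0; apply: val_inj; apply/funext => k; apply/eqP; rewrite -normr_le0.
by rewrite -a0 ell2_norm_coord.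
Qed.

HB.instance Definition _ :=
  Lmodule_isNormed.Build R ell2 ell2_normD ell2_normZ ell2_norm0_eq0.

Lemma ell2_normE (a : ell2) : `|a| = ell2_norm a. Proof. by []. Qed.

(** Coordinates are dominated by the norm, hence converge along the filter. Only finitely many
    coordinates enter a partial sum, so smallness of x - y for y in a small set of the filter passes
    to the coordinatewise limit, uniformly in the number of coordinates. *)
Lemma ell2_complete (F : set_system ell2) : ProperFilter F -> cauchy F -> cvg F.
Proof.
move=> FF /cauchy_ballP Fc.
have Fc2 e : 0 < e -> exists2 A, F A & forall x y, A x -> A y -> `|x - y| <= e.
  move=> e0; have [[A B] /= [FA FB] AB] := Fc e e0.
  exists (A `&` B); first exact: filterI.
  move=> x y [Ax _] [_ By]; apply: ltW.
  by have := AB (x, y) (conj Ax By); rewrite /= -ball_normE.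
have cl k : cvg ((fun a : ell2 => val a k) @ F).
  apply/cauchy_cvgP/cauchy_ballP => e e0.
  have [A FA AA] := Fc2 (e / 2) (divr_gt0 e0 (ltr0Sn _ _)).
  exists ([set val a k | a in A], [set val a k | a in A]).
    by split; move: FA; apply: (@filterS _ F) => a Aa; exists a.
  move=> [_ _] [/= [a Aa <-] [b Ab <-]] /=; rewrite /ball/=.
  apply: le_lt_trans (_ : e / 2 < e); last by rewrite ltr_pdivrMr// ltr_pMr// ltr1n.
  exact: le_trans (ell2_norm_coord (a - b) k) (AA _ _ Aa Ab).
pose l k : R := lim ((fun a : ell2 => val a k) @ F).
have dl e A (x : ell2) n : F A -> (forall x y, A x -> A y -> `|x - y| <= e) -> A x ->
    Num.sqrt (sqsum (val x - l) n) <= e.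
  move=> FA AA Ax; have e0 : 0 <= e by apply: le_trans (AA x x Ax Ax).
  rewrite -[e]ger0_norm// -sqrtr_sqr ler_wsqrtr//.
  have cv : (fun y : ell2 => sqsum (val x - val y) n) @ F --> sqsum (val x - l) n.
    elim: n => [|n IH].
      rewrite (_ : (fun _ => _) = cst 0); last by apply/funext => y; rewrite /sqsum big_ord0.
      by rewrite /sqsum big_ord0; exact: cvg_cst.
    rewrite /sqsum big_ord_recr/= expr2; under eq_fun do rewrite big_ord_recr/= expr2.
    have cn : (fun y : ell2 => val x n - val y n) @ F --> val x n - l n.
      by apply: cvgB; [exact: cvg_cst|exact: cl].
    by apply: cvgD => //; exact: cvgM.
  rewrite -(cvg_lim _ cv)//; apply: limr_le; first by apply/cvg_ex; eexists; exact: cv.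
  apply: filterS FA => y Ay.
  rewrite -[leRHS]sqr_sqrtr ?sqr_ge0// sqrtr_sqr ger0_norm//.
  rewrite -[leLHS]sqr_sqrtr ?sqsum_ge0// ler_sqr ?nnegrE ?sqrtr_ge0//.
  exact: le_trans (ell2_norm_ub (x - y) n) (AA _ _ Ax Ay).
have [A FA AA] := Fc2 1 ltr01.
have [x Ax] := filter_ex FA.
have ls : l \in sqsummable.
  (* The limit is x - (x - l), and x - l has partial norms at most 1. *)
  rewrite -(subKr (val x) l) rpredB//; first exact: valP.
  by apply/sqsummableP; exists 1 => n; exact: (dl _ _ _ _ FA AA Ax).
apply/cvg_ex; exists (Ell2 l ls); apply/cvgrPdist_le => e e0.
have [B FB BB] := Fc2 e e0.
apply: (filterS _ FB) => y By; rewrite distrC.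
by apply: ell2_norm_le => n; exact: (dl _ _ _ _ FB BB By).
Qed.

HB.instance Definition _ := Uniform_isComplete.Build ell2 ell2_complete.

End square_summable.

Section ell2_truncation.
Variable R : realType.
Implicit Types (a : nat -> R) (n : nat).

Definition truncate n a : nat -> R := fun k => if (k < n)%N then a k else 0.

Lemma sqsum_truncate n a m :
  sqsum R (truncate n a) m = sqsum R a (minn n m).
Proof.
elim: m => [|m IH]; first by rewrite minn0 /sqsum !big_ord0.
rewrite {1}/sqsum big_ord_recr/= -/(sqsum R (truncate n a) m) IH /truncate.
have [mn|nm] := ltnP m n.
  by rewrite (minn_idPr mn) /sqsum big_ord_recr.
by rewrite (minn_idPl (leqW nm)) expr0n addr0.
Qed.

Lemma sqsum_sub_truncate n a m :
  sqsum R (a - truncate n a) m = sqsum R a m - sqsum R a (minn n m).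
Proof.
elim: m => [|m IH]; first by rewrite minn0 /sqsum !big_ord0 subr0.
rewrite {1}/sqsum big_ord_recr/= -/(sqsum R (a - truncate n a) m) IH.
rewrite [in RHS]/sqsum [in RHS]big_ord_recr/= -/(sqsum R a m).
rewrite (_ : (a - _) m = a m - truncate n a m)// /truncate.
have [mn|nm] := ltnP m n.
  rewrite (minn_idPr mn) !subrr expr0n/= addr0.
  by rewrite [in RHS]big_ord_recr/= -/(sqsum R a m) !subrr.
by rewrite (minn_idPl (leqW nm)) subr0 addrAC.
Qed.

Lemma truncate_sqsummable n a : truncate n a \in sqsummable R.
Proof.
apply/sqsummableP; exists (Num.sqrt (sqsum R a n)) => m.
by rewrite sqsum_truncate ler_wsqrtr// sqsum_le// geq_minl.
Qed.

Definition ell2_truncate n (a : ell2 R) : ell2 R :=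
  Ell2 R (truncate n (val a)) (truncate_sqsummable n (val a)).

Lemma ell2_truncate_near (a : ell2 R) e : 0 < e ->
  exists N, forall n, (N <= n)%N -> `|a - ell2_truncate n a| <= e.
Proof.
move=> e0.
(* With M the norm, a partial norm above M - d leaves a squared tail of at most M^2 - (M - d)^2 <= 2
   d M, and d is chosen so that 2 d (M + 1) is e^2; the + 1 covers M = 0. *)
pose d : R := e ^+ 2 / (2 * (`|a| + 1)).
have a1 : 0 < 2 * (`|a| + 1) :> R by rewrite mulr_gt0// ltr_wpDl.
have d0 : 0 < d by rewrite divr_gt0// exprn_gt0.
have hs : has_sup (range (fun n => Num.sqrt (sqsum R (val a) n))).
  split; first by exists (Num.sqrt (sqsum R (val a) 0)); exists 0.
  by exists (ell2_norm R a) => _ [n _ <-]; exact: ell2_norm_ub.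
have [_ [N _ <-]] := sup_adherent d0 hs; rewrite -/(ell2_norm R a) => hN.
exists N => n Nn; apply: ell2_norm_le => m.
rewrite [val _](_ : _ = val a - truncate n (val a))// sqsum_sub_truncate.
rewrite -[e]ger0_norm ?(ltW e0)// -sqrtr_sqr ler_wsqrtr//.
have [mn|nm] := leqP m n.
  by rewrite subrr sqr_ge0.
set x := sqsum R (val a) m; set y := sqsum R (val a) n; set M := ell2_norm R a in hN *.
have M0 : 0 <= M := ell2_norm_ge0 R a.
have xM : x <= M ^+ 2.
  rewrite -[x]sqr_sqrtr ?sqsum_ge0// ler_sqr ?nnegrE ?sqrtr_ge0//.
  exact: ell2_norm_ub.
have ex : e ^+ 2 = d * (2 * (M + 1)) by rewrite /d /M -ell2_normE divfK// gt_eqF.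
(* If M <= d, the bound M - d cannot be squared, but M^2 <= d M is already enough. *)
have [Md|dM] := leP M d; first by rewrite ex; have := sqsum_ge0 R (val a) n; rewrite -/y; nra.
have yM : (M - d) ^+ 2 <= y.
  rewrite -[y]sqr_sqrtr ?sqsum_ge0// ler_sqr ?nnegrE ?sqrtr_ge0//; last first.
    by rewrite subr_ge0 ltW.
  by apply: le_trans (ltW hN) _; rewrite ler_wsqrtr// sqsum_le.
rewrite ex; nra.
Qed.

End ell2_truncation.

(** * Uniqueness of completions *)

Section completion_uniqueness.
Variables (R : realType) (P : set (R -> R)) (N : (R -> R) -> R).
Hypothesis Plin : forall (t : R) f g, P f -> P g -> P (fun x => t * f x + g x).

(* [x] and [y] are limits of the same sequence of [P] in the two completions. *)
Definition completion_rel (E F : completeNormedModType R)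
    (i : (R -> R) -> E) (j : (R -> R) -> F) (x : E) (y : F) :=
  forall e : R, 0 < e -> exists p, [/\ P p, `|x - i p| < e & `|y - j p| < e].

Lemma completion_relC E F i j x y :
  completion_rel E F i j x y -> completion_rel F E j i y x.
Proof. by move=> xy e /xy[p [Pp h1 h2]]; exists p. Qed.

Lemma completion_rel_poly E F i j p : P p -> completion_rel E F i j (i p) (j p).
Proof. by move=> Pp e e0; exists p; rewrite !subrr !normr0. Qed.

Section isometry.
Variables (E F : completeNormedModType R) (i : (R -> R) -> E) (j : (R -> R) -> F).
Hypotheses (iE : is_completion P N i) (jF : is_completion P N j).
Local Notation rel := (completion_rel E F i j).

Lemma completion_rel_linear t x y x' y' :
  rel x y -> rel x' y' -> rel (t *: x + x') (t *: y + y').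
Proof.
move=> xy xy' e e0.
(* The first error gets multiplied by |t|, so it is required to be below e / (2 (|t| + 1)); the + 1
   allows t = 0. *)
have t0 : 0 < `|t| + 1 by rewrite ltr_wpDl.
have [p [Pp xp yp]] := xy _ (divr_gt0 e0 (mulr_gt0 (ltr0Sn R 1) t0)).
have [q [Pq xq yq]] := xy' _ (divr_gt0 e0 (ltr0Sn R 1)).
have [ilin _ _] := iE; have [jlin _ _] := jF.
have aux (V : normedModType R) (u v u' v' : V) :
    `|u - u'| < e / (2 * (`|t| + 1)) -> `|v - v'| < e / 2 ->
    `|(t *: u + v) - (t *: u' + v')| < e.
  move=> uu vv; rewrite opprD addrACA -scalerBr.
  apply: le_lt_trans (ler_normD _ _) _; rewrite normrZ [e]splitr ler_ltD//.
  apply: le_trans (_ : `|t| * (e / (2 * (`|t| + 1))) <= _).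
    by rewrite ler_wpM2l// ltW.
  rewrite [leLHS](_ : _ = e / 2 * (`|t| / (`|t| + 1))); last first.
    by field; exact: lt0r_neq0.
  rewrite ler_piMr ?divr_ge0 ?(ltW e0)//.
  by rewrite ler_pdivrMr// mul1r lerDl.
exists (fun x => t * p x + q x); split; first exact: Plin.
- by rewrite ilin//; exact: aux.
- by rewrite jlin//; exact: aux.
Qed.

(** A common approximant p has the same norm N p in both completions. *)
Lemma completion_rel_norm_le x y : rel x y -> `|y| <= `|x|.
Proof.
move=> xy; apply/ler_addgt0Pr => e e0.
have [p [Pp xp yp]] := xy _ (divr_gt0 e0 (ltr0Sn R 1)).
have [_ iN _] := iE; have [_ jN _] := jF.
have h1 : `|y| <= e / 2 + `|j p|.
  rewrite -{1}(subrK (j p) y); apply: le_trans (ler_normD _ _) _.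
  by rewrite lerD2r ltW.
have h2 : `|i p| <= `|x| + e / 2.
  rewrite -{1}(subrK x (i p)) addrC; apply: le_trans (ler_normD _ _) _.
  by rewrite lerD2l distrC ltW.
rewrite jN// -iN// in h1; apply: le_trans h1 _.
by rewrite [e in leRHS]splitr addrCA lerD2l addrC addrC.
Qed.

(** Density supplies p_n with i p_n tending to x. Since i and j induce the same distance on P, the
    sequence j p_n is Cauchy, and its limit is the wanted point. *)
Lemma completion_rel_ex x : exists y, rel x y.
Proof.
have [ilin iN idense] := iE; have [jlin jN _] := jF.
have near_x n : exists p, P p /\ `|x - i p| < n.+1%:R^-1.
  have n0 : 0 < n.+1%:R^-1 :> R by rewrite invr_gt0.
  have [|y [xp [p Pp py]]] := idense (ball x n.+1%:R^-1) _ (ball_open x _).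
    by exists x; exact: ballxx.
  by exists p; split=> //; move: xp; rewrite -py -ball_normE.
have [p pP] := choice near_x.
have dist q r : P q -> P r -> `|j q - j r| = `|i q - i r|.
  move=> Pq Pr.
  (* [is_completion] offers linearity only for combinations of the form a f + g. *)
  have -> : j q - j r = j (fun x => -1 * r x + q x).
    by rewrite jlin// scaleN1r addrC.
  have -> : i q - i r = i (fun x => -1 * r x + q x).
    by rewrite ilin// scaleN1r addrC.
  by rewrite jN ?iN//; exact: Plin.
have inv0 e : 0 < e -> \forall n \near \oo, n.+1%:R^-1 < e :> R.
  by move=> e0; exact: near_infty_natSinv_lt (PosNum e0).
have cj : cvg (j \o p @ \oo).
  apply: cauchy_cvg; apply/cauchyP => e e0.
  have e20 : 0 < e / 2 by rewrite divr_gt0.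
  have [n0 _ hn] := inv0 _ e20.
  exists (j (p n0)); exists n0 => // n /= nn; rewrite -ball_normE/=.
  have [Pn xn] := pP n; have [P0 x0] := pP n0.
  rewrite dist// -(subrK x (i (p n0))) -addrA.
  apply: le_lt_trans (ler_normD _ _) _; rewrite [e]splitr ltrD//.
    by rewrite distrC; apply: lt_trans x0 (hn _ _); rewrite /= leqnn.
  by apply: lt_trans xn (hn _ _).
exists (lim (j \o p @ \oo)) => e e0.
have /cvgrPdist_lt/(_ e e0)[n1 _ h1] := cj.
have [n2 _ h2] := inv0 _ e0.
exists (p (maxn n1 n2)); have [Pn xn] := pP (maxn n1 n2); split=> //.
  by apply: lt_trans xn (h2 _ _); rewrite /= leq_maxr.
by apply: h1; rewrite /= leq_maxl.
Qed.

End isometry.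

(** The relation is total in both directions and, being linear and norm-preserving, preserves
    distances. It is therefore single-valued both ways: the graph of an isometric bijection. *)
Lemma completion_unique (E F : completeNormedModType R)
    (i : (R -> R) -> E) (j : (R -> R) -> F) :
  is_completion P N i -> is_completion P N j ->
  exists (V : E -> F) (W : F -> E), [/\ linear V, cancel V W, cancel W V,
    forall x, `|V x| = `|x| & forall p, P p -> V (i p) = j p].
Proof.
move=> iE jF.
have Vex x : exists y, completion_rel E F i j x y by exact: completion_rel_ex iE jF x.
have Wex y : exists x, completion_rel E F i j x y.
  have [x yx] := completion_rel_ex _ _ _ _ jF iE y.
  by exists x; exact: completion_relC.
have [V VP] := choice Vex; have [W WP] := choice Wex.
have norm x y : completion_rel E F i j x y -> `|y| = `|x|.
  move=> xy; apply/eqP; rewrite eq_le (completion_rel_norm_le _ _ _ _ iE jF)//=.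
  exact: (completion_rel_norm_le _ _ _ _ jF iE) (completion_relC _ _ _ _ _ _ xy).
have sub x y x' y' : completion_rel E F i j x y -> completion_rel E F i j x' y' ->
    `|y - y'| = `|x - x'|.
  move=> h h'; apply: norm.
  by have := completion_rel_linear _ _ _ _ iE jF (-1) _ _ _ _ h' h;
    rewrite !scaleN1r 2![- _ + _]addrC.
have uniqy x y y' : completion_rel E F i j x y -> completion_rel E F i j x y' -> y = y'.
  move=> h h'; apply/eqP; rewrite -subr_eq0 -normr_eq0.
  by rewrite (sub _ _ _ _ h h') subrr normr0.
have uniqx x x' y : completion_rel E F i j x y -> completion_rel E F i j x' y -> x = x'.
  move=> h h'; apply/eqP; rewrite -subr_eq0 -normr_eq0.
  by rewrite -(sub _ _ _ _ h h') subrr normr0.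
exists V, W; split.
- move=> t x x'; apply: uniqy (VP _) _.
  exact: completion_rel_linear iE jF _ _ _ _ _ (VP _) (VP _).
- by move=> x; exact: uniqx (WP _) (VP _).
- by move=> y; exact: uniqy (VP _) (WP _).
- by move=> x; exact: norm.
- by move=> p Pp; apply: uniqy (VP _) (completion_rel_poly _ _ _ _ _ Pp).
Qed.

End completion_uniqueness.

(** * Orthogonality of the trigonometric system *)

Section unit_interval_integral.
Variable R : realType.
Local Notation leb := (@lebesgue_measure R).
Local Notation I01 f := (\int[leb]_(x in `[0, 1]) f x).
Implicit Types f g : R -> R.

Lemma continuous_integrable01 f : continuous f ->
  leb.-integrable `[0, 1] (EFin \o f).
Proof.
move=> cf; apply: continuous_compact_integrable; first exact: segment_compact.
exact: continuous_subspaceT.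
Qed.

Lemma eq_Rintegral01 g f : f =1 g -> I01 f = I01 g.
Proof. by move=> fg; apply: eq_Rintegral => x _; exact: fg. Qed.

Lemma Rintegral01D f g : continuous f -> continuous g ->
  I01 (fun x => f x + g x) = I01 f + I01 g.
Proof. by move=> cf cg; rewrite RintegralD//; exact: continuous_integrable01. Qed.

Lemma Rintegral01Z (r : R) f : continuous f ->
  I01 (fun x => r * f x) = r * I01 f.
Proof. by move=> cf; rewrite RintegralZl//; exact: continuous_integrable01. Qed.

Lemma Rintegral01_cst (r : R) : I01 (cst r) = r.
Proof.
by rewrite Rintegral_cst//= lebesgue_measure_itv/= lte_fin ltr01 sube0/= mulr1.
Qed.

Lemma continuous_sum n (f : nat -> R -> R) : (forall k, continuous (f k)) ->
  continuous (fun x => \sum_(k < n) f k x).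
Proof.
move=> cf; elim: n => [|n IH].
  by under eq_fun do rewrite big_ord0; move=> x; exact: cvg_cst.
under eq_fun do rewrite big_ord_recr/=.
by move=> x; apply: cvgD; [exact: IH|exact: cf].
Qed.

Lemma continuous_sqr f : continuous f -> continuous (fun x => f x ^+ 2).
Proof. by move=> cf x; exact: (cvgM (cf x) (cf x)). Qed.

Lemma Rintegral01_sum n (f : nat -> R -> R) : (forall k, continuous (f k)) ->
  I01 (fun x => \sum_(k < n) f k x) = \sum_(k < n) I01 (f k).
Proof.
move=> cf; elim: n => [|n IH].
  rewrite big_ord0 (eq_Rintegral01 (cst 0)) ?Rintegral01_cst// => x.
  by rewrite big_ord0.
rewrite big_ord_recr/= -IH -Rintegral01D//; last exact: continuous_sum.
by apply: eq_Rintegral => x _; rewrite big_ord_recr.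
Qed.

Lemma Rintegral01_FTC f (F : R -> R) : continuous f ->
  (forall x : R, is_derive x 1 F (f x)) -> I01 f = F 1 - F 0.
Proof.
move=> cf dF.
have cF : continuous F.
  by move=> x; apply/differentiable_continuous/derivable1_diffP; have [] := dF x.
rewrite /Rintegral (@continuous_FTC2 _ f F)//.
- exact: continuous_subspaceT.
- split=> [x _| |]; first by have [] := dF x.
  + exact/cvg_at_right_filter/cF.
  + exact/cvg_at_left_filter/cF.
- by move=> x _; rewrite derive1E; have [] := dF x.
Qed.

End unit_interval_integral.

Section trigonometric_orthogonality.
Variable R : realType.
Local Notation leb := (@lebesgue_measure R).
Local Notation I01 f := (\int[leb]_(x in `[0, 1]) f x).
Local Notation pi := (@trigo.pi R).
Implicit Types (j k n : nat) (a b : nat -> R).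

Lemma continuous_cosM (c : R) : continuous (fun x : R => cos (c * x)).
Proof.
move=> x; apply: (@continuous_comp _ _ _ ( *%R c) cos); last exact: continuous_cos.
exact: mulrl_continuous.
Qed.

Lemma continuous_sinM (c : R) : continuous (fun x : R => sin (c * x)).
Proof.
move=> x; apply: (@continuous_comp _ _ _ ( *%R c) sin); last exact: continuous_sin.
exact: mulrl_continuous.
Qed.

Lemma sin_natpi k : sin (k%:R * pi) = 0.
Proof.
elim: k => [|k IH]; first by rewrite mul0r sin0.
by rewrite -natr1 mulrDl mul1r sinD IH sinpi mul0r mulr0 addr0.
Qed.

Lemma is_derive_mull (c x : R) : is_derive x 1 ( *%R c) c.
Proof.
rewrite -[X in is_derive _ _ _ X](mulr1 c).
exact: (is_deriveZ c (is_derive_id x 1)).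
Qed.

Lemma is_derive_sinM (c x : R) :
  is_derive x 1 (fun x => sin (c * x)) (c * cos (c * x)).
Proof.
have := @is_derive1_comp R sin ( *%R c) x _ _ (is_derive_sin _) (is_derive_mull c x).
by rewrite mulrC.
Qed.

Lemma is_derive_cosM (c x : R) :
  is_derive x 1 (fun x => cos (c * x)) (- c * sin (c * x)).
Proof.
have := @is_derive1_comp R cos ( *%R c) x _ _ (is_derive_cos _) (is_derive_mull c x).
by rewrite mulrC mulrN mulNr.
Qed.

Lemma Rintegral01_cos (c : R) : c != 0 -> I01 (fun x => cos (c * x)) = c^-1 * sin c.
Proof.
move=> c0; have dF (x : R) : is_derive x 1 (fun x => c^-1 * sin (c * x)) (cos (c * x)).
  rewrite -[X in is_derive _ _ _ X](mulKf c0).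
  exact: (is_deriveZ c^-1 (is_derive_sinM c x)).
rewrite (Rintegral01_FTC _ _ _ (continuous_cosM c) dF).
by rewrite mulr0 sin0 mulr0 subr0 mulr1.
Qed.

(** The boolean packs the frequencies j - k ([true]) and j + k ([false]) of the product formulas.
    When the frequency is nonzero, the primitive is a sine of integer multiples of pi at both
    endpoints. *)
Lemma Rintegral01_cosD (j k : nat) (e : bool) :
  I01 (fun x => cos ((j%:R * pi + (-1) ^+ e * (k%:R * pi)) * x)) =
  ((j%:R : R) + (-1) ^+ e * k%:R == 0)%:R.
Proof.
rewrite mulrA -mulrDl; have [->|jk0] := eqVneq (_ + _) 0.
  rewrite (eq_Rintegral01 _ (cst 1)); last by move=> x; rewrite !mul0r cos0.
  exact: Rintegral01_cst.
have pi0 : pi != 0 by rewrite gt_eqF ?pi_gt0.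
rewrite Rintegral01_cos ?mulf_neq0// mulrDl -mulrA sinD sin_natpi mul0r add0r.
by case: e {jk0}; rewrite ?expr1 ?mulN1r ?mul1r ?sinN sin_natpi ?oppr0 !mulr0.
Qed.

Lemma cos_mul_sum (x y : R) : cos x * cos y = 2^-1 * (cos (x - y) + cos (x + y)).
Proof. by rewrite cosB cosD; field. Qed.

Lemma sin_mul_sum (x y : R) : sin x * sin y = 2^-1 * (cos (x - y) + - cos (x + y)).
Proof. by rewrite cosB cosD; field. Qed.

Lemma natr_addN_eq0 j k : ((j%:R : R) + (-1) ^+ true * k%:R == 0) = (j == k).
Proof. by rewrite mulN1r subr_eq0 eqr_nat. Qed.

Lemma natr_addP_eq0 j k :
  ((j%:R : R) + (-1) ^+ false * k%:R == 0) = (j == 0) && (k == 0).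
Proof. by rewrite mul1r -natrD pnatr_eq0 addn_eq0. Qed.

Lemma cos_orthogonal j k :
  I01 (fun x => cos (j%:R * pi * x) * cos (k%:R * pi * x)) =
  (j == k)%:R * (if j == 0%N then 1 else 2^-1).
Proof.
pose c (e : bool) x : R := cos ((j%:R * pi + (-1) ^+ e * (k%:R * pi)) * x).
rewrite (eq_Rintegral01 _ (fun x => 2^-1 * (c true x + c false x))); last first.
  by move=> x; rewrite cos_mul_sum /c/= !mulrDl mulN1r mul1r mulNr.
have cc e : continuous (c e) by exact: continuous_cosM.
rewrite Rintegral01Z; last by move=> x; apply: cvgD; exact: cc.
rewrite Rintegral01D// !Rintegral01_cosD natr_addN_eq0 natr_addP_eq0.
have [<-|jk] := eqVneq j k; first by rewrite andbb; case: eqP => _; rewrite ?mulr1n ?mulr0n; field.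
by rewrite mul0r add0r; case: j k jk {c cc} => [|j] [|k]//=; rewrite ?mulr0.
Qed.

Lemma sin_orthogonal j k :
  I01 (fun x => sin (j%:R * pi * x) * sin (k%:R * pi * x)) =
  (j == k)%:R * (if j == 0%N then 0 else 2^-1).
Proof.
pose c (e : bool) x : R := cos ((j%:R * pi + (-1) ^+ e * (k%:R * pi)) * x).
rewrite (eq_Rintegral01 _ (fun x => 2^-1 * (c true x + -1 * c false x))); last first.
  by move=> x; rewrite sin_mul_sum /c/= !mulrDl !mulN1r mul1r mulNr.
have cc e : continuous (c e) by exact: continuous_cosM.
have cN : continuous (fun x => -1 * c false x).
  by move=> x; apply: cvgM; [exact: cvg_cst|exact: cc].
rewrite Rintegral01Z; last by move=> x; apply: cvgD; [exact: cc|exact: cN].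
rewrite Rintegral01D// Rintegral01Z// !Rintegral01_cosD natr_addN_eq0 natr_addP_eq0.
have [<-|jk] := eqVneq j k; first by rewrite andbb; case: eqP => _; rewrite ?mulr1n ?mulr0n; field.
by rewrite mul0r add0r; case: j k jk {c cc cN} => [|j] [|k]//=; rewrite ?mulr0.
Qed.

Lemma Rintegral01_sqr_sum n (g : nat -> R -> R) (d a : nat -> R) :
  (forall k, continuous (g k)) ->
  (forall j k, I01 (fun x => g j x * g k x) = (j == k)%:R * d j) ->
  I01 (fun x => (\sum_(k < n) a k * g k x) ^+ 2) = \sum_(k < n) a k ^+ 2 * d k.
Proof.
move=> cg gd.
pose G j k x := (a j * a k) * (g j x * g k x).
have cgg j k : continuous (fun x => g j x * g k x).
  by move=> x; apply: cvgM; exact: cg.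
have cG j k : continuous (G j k).
  by move=> x; apply: cvgM; [exact: cvg_cst|exact: cgg].
rewrite (eq_Rintegral01 _ (fun x => \sum_(j < n) \sum_(k < n) G j k x)); last first.
  move=> x; rewrite expr2 mulr_suml; apply: eq_bigr => j _.
  rewrite mulr_sumr; apply: eq_bigr => k _; rewrite /G; ring.
rewrite (@Rintegral01_sum _ _ (fun j x => \sum_(k < n) G j k x)); last first.
  by move=> j; apply: (@continuous_sum _ _ (fun k => G j k)).
apply: eq_bigr => j _; rewrite (@Rintegral01_sum _ _ (fun k => G j k))//.
rewrite (bigD1 j)//= big1 ?addr0 => [|k kj].
  by rewrite /G Rintegral01Z// gd eqxx mul1r expr2.
rewrite /G Rintegral01Z// gd.
by rewrite (_ : (nat_of_ord j == k) = false) ?mul0r ?mulr0//; rewrite eq_sym; exact: negbTE.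
Qed.

End trigonometric_orthogonality.

(** * Diagonalization of the fractional form *)

Section interval_changes_of_variables.
Variable R : realType.
Local Notation leb := (@lebesgue_measure R).
Local Open Scope ereal_scope.
Implicit Types (f : R -> \bar R) (a b c : R).

Lemma measurable_addr c :
  measurable_fun setT ((fun x => x + c)%R : measurableTypeR R -> measurableTypeR R).
Proof. exact: measurable_funD. Qed.

(** The pushforward gives every half-open interval its length, which characterizes Lebesgue
    measure. *)
Lemma lebesgue_measure_addr c (A : set R) : measurable A ->
  pushforward leb ((fun x => x + c)%R : _ -> measurableTypeR R) A = leb A.
Proof.
move=> mA; apply/esym.
pose shift : {mfun measurableTypeR R >-> measurableTypeR R} :=
  HB.pack ((fun x => x + c)%R : measurableTypeR R -> measurableTypeR R)
    (isMeasurableFun.Build _ _ _ _ _ (measurable_addr c)).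
apply: (@lebesgue_measure_unique R (pushforward leb shift)) => // _ [[x y]] _ <-.
rewrite /= /pushforward.
rewrite (_ : _ @^-1` _ = `](x - c)%R, (y - c)%R]%classic); last first.
  by apply/seteqP; split => z /=; rewrite !in_itv/= ltrBlDr lerBrDr.
rewrite !lebesgue_measure_itv/= !lte_fin ltrD2r.
by rewrite -!EFinD opprB addrA subrK.
Qed.

Lemma ge0_integral_addr f a b c : measurable_fun setT f -> (forall x, 0 <= f x) ->
  \int[leb]_(x in `[a, b]) f (x + c)%R = \int[leb]_(x in `[(a + c)%R, (b + c)%R]) f x.
Proof.
move=> mf f0; rewrite (_ : `[a, b]%classic =
    ((fun x => x + c)%R : _ -> measurableTypeR R) @^-1` `[(a + c)%R, (b + c)%R]); last first.
  by apply/seteqP; split => z /=; rewrite !in_itv/= !lerD2r.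
rewrite -(@ge0_integral_pushforward _ _ _ _ _ _ (measurable_addr c) leb _ f)//=; last first.
  exact: measurable_funTS.
apply: eq_measure_integral; first exact: (measurable_addr c).
by move=> mf' A mA _; exact: lebesgue_measure_addr.
Qed.

Lemma ge0_integral_opp f a b : measurable_fun setT f -> (forall x, 0 <= f x) ->
  \int[leb]_(x in `[a, b]) f (- x)%R = \int[leb]_(x in `[(- b)%R, (- a)%R]) f x.
Proof.
move=> mf f0; rewrite (_ : `[a, b]%classic =
    (-%R : _ -> measurableTypeR R) @^-1` `[(- b)%R, (- a)%R]); last first.
  by rewrite opp_preimage_itvbndbnd/= !opprK.
rewrite -ge0_integral_pushforward//=; last exact: measurable_funTS.
by apply: eq_measure_integral => //= A mA AS; exact: lebesgue_measureN.
Qed.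

Lemma ge0_integral_itv_split f a b c : measurable_fun setT f -> (forall x, 0 <= f x) ->
  (a <= b)%R -> (b <= c)%R ->
  \int[leb]_(x in `[a, c]) f x =
  \int[leb]_(x in `[a, b]) f x + \int[leb]_(x in `[b, c]) f x.
Proof.
move=> mf f0 ab bc; rewrite -(@integral_itv_obnd_cbnd _ b); last exact: measurable_funTS.
rewrite -ge0_integral_setU//.
- congr (integral _ _ _); rewrite -itv_bndbnd_setU// bnd_simp//.
- exact: measurable_funTS.
- apply/disj_setPS => z /= []; rewrite !in_itv/= => /andP[_ zb] /andP[bz _].
  by move: bz; rewrite ltNge zb.
Qed.

(** The shifted interval is cut at 1, and the part beyond 1 is moved back by the period 2 onto
    [-1, -1 + c]. *)
Lemma ge0_integral_periodic f c : measurable_fun setT f -> (forall x, 0 <= f x) ->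
  (forall x, f (x + 2)%R = f x) -> (0 <= c <= 2)%R ->
  \int[leb]_(x in `[(-1)%R, 1%R]) f (x + c)%R = \int[leb]_(x in `[(-1)%R, 1%R]) f x.
Proof.
move=> mf f0 f2 /andP[c0 c2]; rewrite ge0_integral_addr//.
rewrite (@ge0_integral_itv_split _ (-1 + c)%R 1 (1 + c)%R)//; [|lra|lra].
rewrite (@ge0_integral_itv_split _ (-1)%R (-1 + c)%R 1)//; [|lra|lra].
rewrite addeC; congr (_ + _).
rewrite (_ : `[1%R, (1 + c)%R]%classic = `[(-1 + 2)%R, ((-1 + c) + 2)%R]%classic); last first.
  have e1 : (-1 + 2 = 1 :> R)%R by ring.
  have e2 : (-1 + c + 2 = 1 + c)%R by ring.
  by rewrite e1 e2.
rewrite -ge0_integral_addr//; apply: eq_integral => x _; exact: f2.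
Qed.

Lemma ge0_integral_prod_rect (f : R * R -> \bar R) (A B : set R) :
  measurable A -> measurable B -> measurable_fun setT f -> (forall z, 0 <= f z) ->
  \int[leb \x leb]_(z in A `*` B) f z = \int[leb]_(x in A) \int[leb]_(y in B) f (x, y).
Proof.
move=> mA mB mf f0; rewrite integral_mkcond fubini_tonelli1; last 2 first.
- apply/(measurable_restrictT _ _).1; first exact: measurableX.
  exact: measurable_funTS.
- by move=> z; apply: erestrict_ge0.
rewrite [RHS]integral_mkcond; apply: eq_integral => x _.
rewrite /fubini_F patchE; case: ifPn => [/set_mem xA|xA].
  rewrite [RHS]integral_mkcond; apply: eq_integral => y _.
  rewrite !patchE; congr (if _ then _ else _).
  by apply/idP/idP; rewrite !inE => //=; case.
rewrite integral0_eq// => y _; rewrite patchE; case: ifPn => // /set_mem[/= xA' _].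
by move: xA; rewrite mem_set.
Qed.

Lemma ge0_integral_swap (f : R * R -> \bar R) (A B : set R) :
  measurable A -> measurable B -> measurable_fun setT f -> (forall z, 0 <= f z) ->
  \int[leb]_(x in A) \int[leb]_(y in B) f (x, y) =
  \int[leb]_(y in B) \int[leb]_(x in A) f (x, y).
Proof.
move=> mA mB mf f0; pose h := f \_ (A `*` B).
have mh : measurable_fun setT h.
  apply/(measurable_restrictT _ _).1; first exact: measurableX.
  exact: measurable_funTS.
have h0 z : 0 <= h z by apply: erestrict_ge0.
have := @fubini_tonelli _ _ _ _ R leb leb h mh h0.
rewrite [in X in X -> _](_ : \int[leb]_x \int[leb]_y h (x, y) =
  \int[leb]_(x in A) \int[leb]_(y in B) f (x, y)); last first.
  rewrite [RHS]integral_mkcond; apply: eq_integral => x _.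
  rewrite patchE; case: ifPn => [/set_mem xA|xA].
    rewrite [RHS]integral_mkcond; apply: eq_integral => y _.
    rewrite /h !patchE; congr (if _ then _ else _).
    by apply/idP/idP; rewrite !inE => //=; case.
  rewrite integral0_eq// => y _; rewrite /h patchE; case: ifPn => // /set_mem[/= xA' _].
  by move: xA; rewrite mem_set.
move=> ->; rewrite [RHS]integral_mkcond; apply: eq_integral => y _.
rewrite patchE; case: ifPn => [/set_mem yB|yB].
  rewrite [RHS]integral_mkcond; apply: eq_integral => x _.
  rewrite /h !patchE; congr (if _ then _ else _).
  by apply/idP/idP; rewrite !inE => //=; case.
rewrite integral0_eq// => x _; rewrite /h patchE; case: ifPn => // /set_mem[/= _ yB'].
by move: yB; rewrite mem_set.
Qed.

End interval_changes_of_variables.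

Section fractional_form.
Variables (R : realType) (alpha : R).
Local Notation leb := (@lebesgue_measure R).
Local Notation pi := (@trigo.pi R).
Local Notation I01 f := (\int[leb]_(x in `[0, 1]) f x).

Definition frac_weight (h : R) : R := (`|sin (pi * h / 2)| `^ (2 * alpha - 1))^-1.
Local Notation W := frac_weight.

Lemma frac_weight_ge0 h : 0 <= W h.
Proof. by rewrite invr_ge0 powR_ge0. Qed.

Lemma frac_weightN h : W (- h) = W h.
Proof. by rewrite /W mulrN mulNr sinN normrN. Qed.

(** The sine changes sign under h + 2, and the absolute value removes the sign. *)
Lemma frac_weight_periodic h : W (h + 2) = W h.
Proof.
by rewrite /W (_ : pi * (h + 2) / 2 = pi * h / 2 + pi) ?sinDpi ?normrN//; field.
Qed.

Lemma measurable_frac_weight : measurable_fun setT (W : measurableTypeR R -> measurableTypeR R).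
Proof.
rewrite (_ : W = fun h => `|sin (pi * h / 2)| `^ (- (2 * alpha - 1))); last first.
  by apply/funext => h; rewrite powRN.
apply: (measurableT_comp (f := fun x : R => x `^ (- (2 * alpha - 1)))) => //.
apply: measurableT_comp => //; apply: measurableT_comp.
  by apply: continuous_measurable_fun; exact: continuous_sin.
by apply: measurable_funM => //; exact: measurable_funM.
Qed.

(** These are the integrals J_k of the overview, kept in [\bar R] because their finiteness is only
    known after [frac_symbol_upper]. *)
Definition frac_symbol (k : nat) : \bar R :=
  (\int[leb]_(h in `[0%R, 1%R]) ((2 - 2 * cos (k%:R * pi * h)) * W h)%:E)%E.

Lemma frac_integrand_ge0 k h : 0 <= (2 - 2 * cos (k%:R * pi * h)) * W h.
Proof. by rewrite mulr_ge0 ?frac_weight_ge0 ?subr_ge0 ?ler_piMr ?cos_le1. Qed.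

Lemma measurable_frac_integrand k : measurable_fun setT
  (fun h : measurableTypeR R => ((2 - 2 * cos (k%:R * pi * h)) * W h)%:E).
Proof.
apply/measurable_EFinP; apply: measurable_funM; last exact: measurable_frac_weight.
apply: measurable_funB; first exact: measurable_cst.
apply: measurable_funM; first exact: measurable_cst.
by apply: continuous_measurable_fun; exact: continuous_cosM.
Qed.

Lemma frac_symbol_ge0 k : (0 <= frac_symbol k)%E.
Proof. by apply: integral_ge0 => h _; rewrite lee_fin frac_integrand_ge0. Qed.

Variables (n : nat) (b : nat -> R).
Definition sine_poly (x : R) : R := \sum_(k < n) b k * sin (k%:R * pi * x).
Local Notation u := sine_poly.

Lemma continuous_sine_poly : continuous u.
Proof.
apply: (@continuous_sum R n (fun k x => b k * sin (k%:R * pi * x))) => k x.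
by apply: cvgM; [exact: cvg_cst|exact: continuous_sinM].
Qed.

Lemma measurable_sine_poly : measurable_fun setT (u : measurableTypeR R -> measurableTypeR R).
Proof. by apply: continuous_measurable_fun; exact: continuous_sine_poly. Qed.

Lemma sine_polyN x : u (- x) = - u x.
Proof.
by rewrite /u -sumrN; apply: eq_bigr => k _; rewrite mulrN sinN mulrN.
Qed.

Lemma sine_poly_periodic x : u (x + 2) = u x.
Proof.
apply: eq_bigr => k _; congr (_ * _); rewrite mulrDr mulr_natr sinD.
rewrite sin_mulr2n cos_mulr2n cos2sin2 sin_natpi expr0n/=.
by rewrite subr0 mulr0 mul0rn mulr0 addr0 mulr2n addrK mulr1.
Qed.

(** The increments are A + B and A - B with A a sine sum and B a cosine sum, so the parallelogram
    law removes the cross term. This matters because sines and cosines are not orthogonal to each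
    other on [0, 1]; pairing h with -h avoids their products. *)
Lemma sine_poly_shift x h :
  (u x - u (h + x)) ^+ 2 + (u x - u (- h + x)) ^+ 2 =
  2 * (\sum_(k < n) (b k * (cos (k%:R * pi * h) - 1)) * sin (k%:R * pi * x)) ^+ 2 +
  2 * (\sum_(k < n) (b k * sin (k%:R * pi * h)) * cos (k%:R * pi * x)) ^+ 2.
Proof.
set A := \sum_(k < n) _ * sin _; set B := \sum_(k < n) _ * cos _.
have -> : u (h + x) = u x + A + B.
  rewrite /u /A /B -!big_split/=; apply: eq_bigr => k _.
  by rewrite mulrDr sinD; ring.
have -> : u (- h + x) = u x + A - B.
  rewrite /u /A /B -sumrN -!big_split/=; apply: eq_bigr => k _.
  by rewrite mulrDr mulrN sinD cosN sinN; ring.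
by ring.
Qed.

Lemma Rintegral_sine_poly_shift h :
  I01 (fun x => (u x - u (h + x)) ^+ 2 + (u x - u (- h + x)) ^+ 2) =
  \sum_(k < n) b k ^+ 2 * (2 - 2 * cos (k%:R * pi * h)).
Proof.
rewrite (eq_Rintegral01 R _ _ (sine_poly_shift ^~ h)).
have cs (c : nat -> R) : continuous (fun x => (\sum_(k < n) c k * sin (k%:R * pi * x)) ^+ 2).
  apply: (continuous_sqr R (fun x => \sum_(k < n) c k * sin (k%:R * pi * x))).
  apply: (@continuous_sum R n (fun k x => c k * sin (k%:R * pi * x))) => k y.
  by apply: cvgM; [exact: cvg_cst|exact: continuous_sinM].
have cc (c : nat -> R) : continuous (fun x => (\sum_(k < n) c k * cos (k%:R * pi * x)) ^+ 2).
  apply: (continuous_sqr R (fun x => \sum_(k < n) c k * cos (k%:R * pi * x))).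
  apply: (@continuous_sum R n (fun k x => c k * cos (k%:R * pi * x))) => k y.
  by apply: cvgM; [exact: cvg_cst|exact: continuous_cosM].
pose c1 k := b k * (cos (k%:R * pi * h) - 1); pose c2 k := b k * sin (k%:R * pi * h).
rewrite Rintegral01D; last 2 first.
- by move=> x; apply: cvgM; [exact: cvg_cst|exact: (cs c1)].
- by move=> x; apply: cvgM; [exact: cvg_cst|exact: (cc c2)].
rewrite (Rintegral01Z _ _ _ (cs c1)) (Rintegral01Z _ _ _ (cc c2)).
rewrite (@Rintegral01_sqr_sum R n (fun k x => sin (k%:R * pi * x))
  (fun k => if k == 0%N then 0 else 2^-1) c1); last 2 first.
- by move=> k; exact: continuous_sinM.
- exact: sin_orthogonal.
rewrite (@Rintegral01_sqr_sum R n (fun k x => cos (k%:R * pi * x))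
  (fun k => if k == 0%N then 1 else 2^-1) c2); last 2 first.
- by move=> k; exact: continuous_cosM.
- exact: cos_orthogonal.
rewrite !mulr_sumr -big_split/=; apply: eq_bigr => k _.
have cs2 := cos2Dsin2 (k%:R * pi * h); rewrite /c1 /c2.
(* At k = 0 the cosine has square integral 1 instead of 1/2, but its coefficient contains sin 0 =
   0. *)
case: eqP => [->|_]; first by rewrite !mul0r cos0 sin0; ring.
set C := cos _ in cs2 *; set S := sin _ in cs2 *.
have -> : 2 - 2 * C = C ^+ 2 + S ^+ 2 + 1 - 2 * C by rewrite cs2; ring.
by field.
Qed.

Local Open Scope ereal_scope.

Let D (z : R * R) : \bar R := ((u z.1 - u z.2) ^+ 2 * W (z.1 - z.2)%R)%:E.

Let D_ge0 z : 0 <= D z.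
Proof. by rewrite lee_fin mulr_ge0 ?sqr_ge0 ?frac_weight_ge0. Qed.

Let measurable_D (d : measure_display) (T : measurableType d) (g1 g2 : T -> measurableTypeR R) :
  measurable_fun setT g1 -> measurable_fun setT g2 ->
  measurable_fun setT (fun t => D (g1 t, g2 t)).
Proof.
move=> m1 m2; apply/measurable_EFinP; apply: measurable_funM.
  apply: measurable_funX; apply: measurable_funB;
    by apply: measurableT_comp => //; exact: measurable_sine_poly.
by apply: measurableT_comp; [exact: measurable_frac_weight|exact: measurable_funB].
Qed.

(* [u] is odd, so the [+] kernel at [y] is the [-] kernel at [-y]; this extends the
   integral to [[-1, 1]], where periodicity allows the shift by [x]. *)
Lemma integral_sine_poly_fold (x : R) : (0 <= x <= 1)%R ->
  \int[leb]_(y in `[0%R, 1%R]) (D (x, y) + D (x, (- y)%R)) =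
  \int[leb]_(h in `[0%R, 1%R]) (D (x, (h + x)%R) + D (x, (- h + x)%R)).
Proof.
move=> /andP[x0 x1].
have mxN (f : R -> R) : measurable_fun setT (f : measurableTypeR R -> measurableTypeR R) ->
    measurable_fun setT (fun y : measurableTypeR R => D (x, f y)).
  by move=> mf; apply: measurable_D => //; exact: measurable_cst.
have mx : measurable_fun setT (fun y : measurableTypeR R => D (x, y)).
  by apply: (mxN id); exact: measurable_id.
(* Both sides fold an integral over [-1, 1] at the origin: that of D(x, .) on the left, that of its
   translate by x on the right. *)
have fold f : measurable_fun setT (f : measurableTypeR R -> \bar R) -> (forall y, 0 <= f y) ->
    \int[leb]_(y in `[0%R, 1%R]) (f y + f (- y)%R) = \int[leb]_(y in `[(-1)%R, 1%R]) f y.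
  move=> mf f0; rewrite (@ge0_integral_itv_split R f (-1) 0 1)//.
  rewrite ge0_integralD//; last 2 first.
  - exact: measurable_funTS.
  - by apply: measurable_funTS; apply: measurableT_comp.
  by rewrite (@ge0_integral_opp R f)// oppr0 addeC.
rewrite (fold _ mx (fun y => D_ge0 _)).
rewrite (fold _ (mxN (+%R^~ x) (measurable_addr R x)) (fun h => D_ge0 _)).
rewrite -(@ge0_integral_periodic R (fun y => D (x, y)) x)//.
- by move=> y; rewrite /D/= sine_poly_periodic opprD addrA
    -(frac_weight_periodic (x - y - 2)) subrK.
- by apply/andP; split; lra.
Qed.

(** All integrands are nonnegative, so the variables can be exchanged without integrability. With h
    outermost, the weight is constant in the inner integral over x, where orthogonality applies. *)
Lemma integral_frac_sine_poly :
  \int[leb \x leb]_(z in `[0%R, 1%R] `*` `[0%R, 1%R])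
    ((u z.1 - u z.2) * (u z.1 - u z.2)
       / `|sin (pi * (z.1 - z.2) / 2)| `^ (2 * alpha - 1) +
     (u z.1 + u z.2) * (u z.1 + u z.2)
       / `|sin (pi * (z.1 + z.2) / 2)| `^ (2 * alpha - 1))%:E =
  \sum_(k < n) (b k ^+ 2)%:E * frac_symbol k.
Proof.
pose F (z : R * R) := D (z.1, z.2) + D (z.1, (- z.2)%R).
pose G (z : R * R) := D (z.1, (z.2 + z.1)%R) + D (z.1, (- z.2 + z.1)%R).
have m1 : measurable_fun setT (fun z : measurableTypeR R * measurableTypeR R => z.1).
  exact: measurable_fst.
have m2 : measurable_fun setT (fun z : measurableTypeR R * measurableTypeR R => z.2).
  exact: measurable_snd.
have mN2 : measurable_fun setT (fun z : measurableTypeR R * measurableTypeR R => (- z.2)%R).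
  exact: measurableT_comp.
have mF : measurable_fun setT (F : measurableTypeR R * measurableTypeR R -> \bar R).
  by apply: emeasurable_funD; exact: measurable_D.
have mG : measurable_fun setT (G : measurableTypeR R * measurableTypeR R -> \bar R).
  by apply: emeasurable_funD; apply: measurable_D => //; exact: measurable_funD.
have F0 z : 0 <= F z by rewrite adde_ge0.
have G0 z : 0 <= G z by rewrite adde_ge0.
rewrite (@eq_integral _ _ _ (leb \x leb) _ F); last first.
  move=> z _; rewrite /F /D -EFinD /= sine_polyN !opprK -!expr2.
  by rewrite /W.
rewrite ge0_integral_prod_rect//.
rewrite (@eq_integral _ _ _ leb _ (fun x => \int[leb]_(h in `[0%R, 1%R]) G (x, h))); last first.
  by move=> x; rewrite inE/= in_itv/= => x01; exact: integral_sine_poly_fold.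
rewrite ge0_integral_swap//.
rewrite (@eq_integral _ _ _ leb _ (fun h => \sum_(k < n) (b k ^+ 2)%:E *
    ((2 - 2 * cos (k%:R * pi * h)) * W h)%:E)); last first.
  move=> h _.
  rewrite (@eq_integral _ _ _ leb _ (fun x => (W h)%:E *
      ((u x - u (h + x)) ^+ 2 + (u x - u (- h + x)) ^+ 2)%:E)); last first.
    move=> x _; rewrite /G /D/= -EFinD -EFinM mulrDr.
    rewrite !opprD !opprK ![(x + _)%R]addrC !addrNK frac_weightN.
    by rewrite ![(_ * W h)%R]mulrC.
  rewrite ge0_integralZl//; last 3 first.
  - apply/measurable_EFinP; apply: measurable_funTS; apply: measurable_funD;
      apply: measurable_funX; apply: measurable_funB; try exact: measurable_sine_poly;
      apply: measurableT_comp; try exact: measurable_sine_poly; exact: measurable_funD.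
  - by move=> x _; rewrite lee_fin addr_ge0 ?sqr_ge0.
  - by rewrite lee_fin frac_weight_ge0.
  (* For fixed h the inner integrand is continuous in x, hence its integral is finite and the
     real-valued formula can be used. *)
  rewrite -[X in _ * X]fineK; last first.
    apply: integrable_fin_num => //; apply: continuous_integrable01.
    have cu c : continuous (fun x => u (c + x)).
      move=> x; apply: (@continuous_comp _ _ _ (+%R c) u); last exact: continuous_sine_poly.
      by apply: cvgD; [exact: cvg_cst|exact: cvg_id].
    have cd c : continuous (fun x => (u x - u (c + x)) ^+ 2)%R.
      apply: (@continuous_sqr R (fun x => u x - u (c + x))%R) => x.
      by apply: cvgB; [exact: continuous_sine_poly|exact: cu].
    by move=> x; apply: cvgD; exact: cd.
  rewrite -/(Rintegral _ _ _) Rintegral_sine_poly_shift -EFinM mulr_sumr -sumEFin.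
  by apply: eq_bigr => k _; rewrite -EFinM; congr EFin; ring.
rewrite ge0_integral_sum//; last 2 first.
- move=> k; apply: measurable_funTS; apply: measurable_funeM.
  exact: measurable_frac_integrand.
- by move=> k h _; rewrite mule_ge0// lee_fin ?sqr_ge0 ?frac_integrand_ge0.
apply: eq_bigr => k _; rewrite ge0_integralZl//.
- by apply: measurable_funTS; exact: measurable_frac_integrand.
- by move=> h _; rewrite lee_fin frac_integrand_ge0.
- by rewrite lee_fin sqr_ge0.
Qed.

End fractional_form.

(** * Growth of the symbol *)

Section sine_bounds.
Variable R : realType.
Local Notation pi := (@trigo.pi R).

Lemma sin_MVT (x : R) : 0 < x -> exists2 y, 0 < y < x & sin x = cos y * x.
Proof.
move=> x0.
have [|y] := @MVT R sin cos 0 x x0 (fun y _ => is_derive_sin y).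
  by apply: continuous_subspaceT; exact: continuous_sin.
by rewrite in_itv/= sin0 !subr0; exists y.
Qed.

Lemma sin_le_id (x : R) : 0 <= x -> sin x <= x.
Proof.
rewrite le_eqVlt => /predU1P[<-|x0]; first by rewrite sin0.
by have [y _ ->] := sin_MVT _ x0; rewrite ler_piMl ?cos_le1// ltW.
Qed.

Lemma sqr_sin_le (x : R) : sin x ^+ 2 <= x ^+ 2.
Proof.
wlog x0 : x / 0 <= x => [h|].
  have [/h//|/ltW x0] := leP 0 x.
  by have := h (- x); rewrite sinN !sqrrN oppr_ge0; exact.
have [xp|px] := leP x pi.
  by rewrite ler_sqr ?nnegrE ?sin_ge0_pi ?x0 ?sin_le_id.
apply: (@le_trans _ _ 1).
  by rewrite sin2cos2 gerBl sqr_ge0.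
by rewrite exprn_ege1// (le_trans _ (ltW px))// (le_trans _ (pi_ge2 R))// ler1n.
Qed.

Lemma two_sub_cos_ge0 (x : R) : 0 <= 2 - 2 * cos x.
Proof. by rewrite subr_ge0 ler_piMr// cos_le1. Qed.

Lemma two_sub_cos_le (x : R) : 2 - 2 * cos x <= x ^+ 2.
Proof.
have -> : 2 - 2 * cos x = 4 * sin (x / 2) ^+ 2.
  rewrite {1}(_ : x = (x / 2) *+ 2); last by rewrite -mulr_natr divfK.
  by rewrite cos_mulr2n cos2sin2; ring.
have := sqr_sin_le (x / 2).
rewrite expr_div_n (_ : 2 ^+ 2 = 4 :> R); last by rewrite -natrX.
by rewrite ler_pdivlMr// mulrC.
Qed.

(** A cruder slope than the optimal 2/pi. On [0, 1] the mean value theorem gives sin x >= x cos 1;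
    beyond 1, sin x >= sin 1 >= cos 1, and the factor 1/2 absorbs x <= pi/2 < 2. *)
Lemma sin_lower (x : R) : 0 <= x <= pi / 2 -> cos 1 / 2 * x <= sin x.
Proof.
move=> /andP[x0 xp]; have c1 := cos1_gt0 R.
have p2 := pihalf_lt2 R; have p1 := pihalf_ge1 R.
have mvt (y : R) : 0 < y <= 1 -> cos 1 * y <= sin y.
  move=> /andP[y0 y1]; have [z /andP[z0 zy] ->] := sin_MVT _ y0.
  rewrite ler_pM2r// ltW// ltr_cos ?in_itv/=; last 2 first.
  - by apply/andP; split; lra.
  - by apply/andP; split; lra.
  - lra.
have [->|xn0] := eqVneq x 0; first by rewrite sin0 mulr0.
have {xn0}x0' : 0 < x by rewrite lt0r xn0.
have [x1|/ltW x1] := leP x 1.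
  apply: le_trans (mvt x _); last by rewrite x0'.
  by rewrite ler_pM2r// ler_piMr ?(ltW c1)// invf_le1// ler1n.
apply: (@le_trans _ _ (sin 1)).
  apply: le_trans (mvt 1 _); last by rewrite ltr01 lexx.
  by rewrite mulr1 -mulrA ler_piMr ?(ltW c1)//; lra.
have [->//|xn1] := eqVneq x 1.
apply: ltW; rewrite ltr_sin ?in_itv/=; [|apply/andP; split; lra..].
by rewrite lt_neqAle eq_sym xn1.
Qed.

End sine_bounds.

Section power_integrals.
Variable R : realType.
Local Notation leb := (@lebesgue_measure R).
Local Open Scope ereal_scope.

Lemma integral_powR (p a c : R) : (p + 1 != 0)%R -> (0 < a)%R -> (a <= c)%R ->
  \int[leb]_(x in `[a, c]) (x `^ p)%:E =
  ((c `^ (p + 1) - a `^ (p + 1)) / (p + 1))%:E.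
Proof.
move=> p1 a0; rewrite le_eqVlt => /predU1P[->|ac].
  by rewrite set_itv1 integral_set1 subrr mul0r.
have dF (x : R) : (0 < x)%R ->
    is_derive x 1%R (fun y => (p + 1)^-1 * (y `^ (p + 1)))%R (x `^ p)%R.
  move=> x0; have := is_deriveZ (p + 1)^-1%R (@is_derive1_powR R (p + 1)%R x x0).
  by rewrite addrK /GRing.scale/= mulKf.
have cpow (q x : R) : (0 < x)%R -> {for x, continuous (fun y : R => y `^ q)%R}.
  move=> x0; apply/differentiable_continuous/derivable1_diffP.
  by have [] := @is_derive1_powR R q x x0.
rewrite (@continuous_FTC2 _ _ (fun y => (p + 1)^-1 * (y `^ (p + 1)))%R)//.
- by rewrite -EFinB -mulrBr mulrC.
- apply: continuous_in_subspaceT => x; rewrite inE/= in_itv/= => /andP[ax _].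
  by apply: cpow; exact: lt_le_trans ax.
- have cF (x : R) : (0 < x)%R -> {for x, continuous (fun y => (p + 1)^-1 * (y `^ (p + 1)))%R}.
    move=> x0; apply/differentiable_continuous/derivable1_diffP.
    by have [] := dF x x0.
  split=> [x| |].
  + by rewrite in_itv/= => /andP[ax _]; have [] := dF x (lt_trans a0 ax).
  + by apply/cvg_at_right_filter/cF.
  + by apply/cvg_at_left_filter/cF/(lt_trans a0).
- by move=> x; rewrite in_itv/= => /andP[ax _]; rewrite derive1E; have [] := dF x (lt_trans a0 ax).
Qed.

(** For negative p the integrand is singular at 0, so the fundamental theorem is applied on
    [a/(n + 1), a] and monotone convergence does the rest. *)
Lemma integral_powR0_le (p a : R) : (0 < p + 1)%R -> (0 < a)%R ->
  \int[leb]_(x in `[0%R, a]) (x `^ p)%:E <= (a `^ (p + 1) / (p + 1))%:E.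
Proof.
move=> p1 a0.
have mp : measurable_fun setT (fun x : measurableTypeR R => (x `^ p)%:E).
  by apply/measurable_EFinP; exact: measurable_powR.
rewrite -integral_itv_obnd_cbnd; last exact: measurable_funTS.
pose F (n : nat) : set R := `[(a / n.+1%:R)%R, a]%classic.
have FE : `]0%R, a]%classic = \bigcup_n F n.
  apply/seteqP; split => [x|x [n _]]; rewrite /F/= !in_itv/= => /andP[x0 xa]; last first.
    by rewrite xa (lt_le_trans _ x0)// divr_gt0.
  exists (Num.truncn (a / x)%R) => //=; rewrite in_itv/= xa andbT.
  by rewrite ler_pdivrMr// -ler_pdivrMl// mulrC ltW// truncnS_gt.
have ndF : nondecreasing_seq F.
  apply/nondecreasing_seqP => n; rewrite subsetEset /F => x /=.
  rewrite !in_itv/= => /andP[nx ->]; rewrite andbT; apply: le_trans nx.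
  by rewrite ler_wpM2l ?(ltW a0)// lef_pV2 ?posrE// ler_nat.
have cv : \int[leb]_(x in F n) (x `^ p)%:E @[n --> \oo] -->
    \int[leb]_(x in \bigcup_n F n) (x `^ p)%:E.
  apply: ge0_nondecreasing_set_cvg_integral => //.
  - by move=> n; exact: measurable_itv.
  - by move=> n; exact: measurable_funTS.
  - by move=> n x _; rewrite lee_fin powR_ge0.
rewrite FE -(cvg_lim _ cv)//; apply: lime_le; first by apply/cvg_ex; eexists; exact: cv.
near=> n; rewrite integral_powR ?gt_eqF ?divr_gt0//; last first.
  by rewrite ler_pdivrMr// ler_peMr ?(ltW a0)// ler1n.
by rewrite lee_fin ler_pM2r ?invr_gt0// gerBl powR_ge0.
Unshelve. all: by end_near. Qed.

End power_integrals.

Section fractional_symbol_bounds.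
Variables (R : realType) (alpha : R).
Hypothesis halpha : 1 < alpha < 2.
Local Notation leb := (@lebesgue_measure R).
Local Notation pi := (@trigo.pi R).
Local Notation W := (frac_weight R alpha).
Local Notation s := (2 * alpha - 1).

Let s1 : 1 < s. Proof. by case/andP: halpha => *; lra. Qed.
Let s3 : s < 3. Proof. by case/andP: halpha => *; lra. Qed.
Let s0 : 0 <= s. Proof. by move: s1; lra. Qed.

Lemma powR_natV (k : nat) (q : R) : (k%:R^-1) `^ q = k%:R `^ (- q).
Proof. by rewrite -powR_inv1// -powRrM mulN1r. Qed.

Lemma natr_powRB1 (k : nat) : (0 < k)%N ->
  k%:R `^ s / k%:R = k%:R `^ (2 * alpha - 2) :> R.
Proof.
move=> k0; have kn0 : k%:R != 0 :> R by rewrite pnatr_eq0 -lt0n.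
rewrite (_ : 2 * alpha - 2 = s - 1); last by ring.
by rewrite [RHS]powRB; [rewrite powRr1|rewrite kn0 implybT].
Qed.

Lemma sin_half_gt0 (h : R) : 0 < h <= 1 -> 0 < sin (pi * h / 2).
Proof.
move=> /andP[h0 h1]; apply: sin_gt0_pi; have p0 := pi_gt0 R.
rewrite -mulrA pmulr_rgt0// divr_gt0//= gtr_pMr//; lra.
Qed.

(** From sin y <= y. The extra point a >= h makes the bound constant over an interval of integration
    ending at a. *)
Lemma frac_weight_lower (h a : R) : 0 < h <= 1 -> h <= a -> (pi / 2 * a) `^ (- s) <= W h.
Proof.
move=> h01 ha; have S0 := sin_half_gt0 _ h01; have /andP[h0 h1] := h01.
have p0 := pi_gt0 R.
rewrite powRN lef_pV2 ?posrE ?powR_gt0 ?normr_gt0 ?gt_eqF//; last first.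
  by rewrite mulr_gt0 ?divr_gt0// (lt_le_trans h0).
rewrite gtr0_norm// ge0_ler_powR ?nnegrE ?(ltW S0)//.
- by rewrite mulr_ge0 ?divr_ge0 ?(ltW p0)// (le_trans (ltW h0)).
- apply: le_trans (sin_le_id _ _ _) _.
    by rewrite !mulr_ge0 ?(ltW p0) ?(ltW h0).
  by rewrite mulrAC ler_wpM2l// divr_ge0// ltW.
Qed.

(** The slope in sin(pi h / 2) >= c1 h, read off from [sin_lower] at pi h / 2. *)
Let c1 : R := cos 1 / 2 * (pi / 2).

Let c1_gt0 : 0 < c1.
Proof. by rewrite !mulr_gt0 ?invr_gt0 ?cos1_gt0 ?pi_gt0. Qed.

Lemma frac_weight_upper (h : R) : 0 < h <= 1 -> W h <= c1 `^ (- s) * h `^ (- s).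
Proof.
move=> h01; have S0 := sin_half_gt0 _ h01; have /andP[h0 h1] := h01.
have p0 := pi_gt0 R.
rewrite -powRM ?(ltW h0) ?(ltW c1_gt0)// powRN.
have ch0 : 0 < c1 * h := mulr_gt0 c1_gt0 h0.
rewrite lef_pV2 ?posrE ?powR_gt0 ?normr_gt0 ?gt_eqF//.
rewrite gtr0_norm// ge0_ler_powR ?nnegrE ?(ltW S0) ?(ltW ch0)//.
rewrite (_ : c1 * h = cos 1 / 2 * (pi * h / 2)); last by rewrite /c1; field.
apply: sin_lower; rewrite !mulr_ge0 ?(ltW p0) ?(ltW h0)//=.
by rewrite ler_wpM2r// ler_piMr// ltW.
Qed.

(** On [1/(2k), 1/k] the phase k pi h lies in [pi/2, pi], so the cosine is nonpositive and the
    factor 2 - 2 cos is at least 2; this 2 cancels the 1/2 in the length of the interval. *)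
Lemma frac_symbol_lower (k : nat) : (0 < k)%N ->
  (((pi / 2) `^ (- s) * k%:R `^ (2 * alpha - 2))%:E <= frac_symbol R alpha k)%E.
Proof.
move=> k0; have k0' : 0 < k%:R :> R by rewrite ltr0n.
have k1' : 1 <= k%:R :> R by rewrite ler1n.
have p0 := pi_gt0 R.
set a : R := k%:R^-1.
have a0 : 0 < a by rewrite invr_gt0.
have a1 : a <= 1 by rewrite invf_le1.
have ka : k%:R * a = 1 by rewrite mulfV// gt_eqF.
apply: (@le_trans _ _ (\int[leb]_(h in `[(a / 2)%R, a]) (2 * (pi / 2 * a) `^ (- s))%:E)%E).
  rewrite integral_cst//= lebesgue_measure_itv/= lte_fin ltr_pdivrMr// ltr_pMr// ltr1n.
  rewrite -EFinB -EFinM lee_fin -natr_powRB1// -/a.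
  rewrite (_ : (pi / 2 * a) `^ (- s) = (pi / 2) `^ (- s) * k%:R `^ s); last first.
    by rewrite powRM ?divr_ge0 ?(ltW p0) ?(ltW a0)// /a powR_natV opprK.
  by rewrite le_eqVlt; apply/orP; left; apply/eqP; field.
apply: (@le_trans _ _ (\int[leb]_(h in `[(a / 2)%R, a])
    ((2 - 2 * cos (k%:R * pi * h)) * W h)%:E)%E).
  apply: ge0_le_integral => //.
  - by move=> h _; rewrite lee_fin mulr_ge0 ?powR_ge0.
  - by apply: measurable_funTS; exact: measurable_frac_integrand.
  - move=> h; rewrite /= in_itv/= => /andP[ah ha]; rewrite lee_fin.
    have h0 : 0 < h by apply: lt_le_trans ah; rewrite divr_gt0.
    apply: ler_pM; rewrite ?powR_ge0//; last first.
      by apply: frac_weight_lower => //; rewrite h0 (le_trans ha a1).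
    rewrite lerBrDl gerDr pmulr_rle0//.
    have -> : cos (k%:R * pi * h) = - sin (k%:R * pi * h - pi / 2).
      by rewrite sinBpihalf opprK.
    rewrite oppr_le0; apply: sin_ge0_pi.
    have : k%:R * (a / 2) <= k%:R * h by rewrite ler_wpM2l// ltW.
    have : k%:R * h <= k%:R * a by rewrite ler_wpM2l// ltW.
    rewrite mulrA ka => kh1 kh2; rewrite (_ : k%:R * pi * h = pi * (k%:R * h)); last by ring.
    by apply/andP; split; nra.
apply: ge0_subset_integral => //.
- by apply: measurable_funTS; exact: measurable_frac_integrand.
- by move=> h _; rewrite lee_fin frac_integrand_ge0.
- move=> h /=; rewrite !in_itv/= => /andP[ah ha].
  by rewrite (le_trans ha a1) andbT (le_trans _ ah)// divr_ge0// ltW.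
Qed.

(** The summands belong to the two pieces of the split at 1/k: on the first, 2 - 2 cos t <= t^2
    yields pi^2/(3 - s); on the second, 2 - 2 cos t <= 4 yields 4/(s - 1). *)
Let Cup : R := c1 `^ (- s) * (pi ^+ 2 / (3 - s) + 4 / (s - 1)).

Lemma frac_symbol_upper (k : nat) : (0 < k)%N ->
  (frac_symbol R alpha k <= (Cup * k%:R `^ (2 * alpha - 2))%:E)%E.
Proof.
move=> k0; have k0' : 0 < k%:R :> R by rewrite ltr0n.
have k1' : 1 <= k%:R :> R by rewrite ler1n.
have p0 := pi_gt0 R.
set a : R := k%:R^-1.
have a0 : 0 < a by rewrite invr_gt0.
have a1 : a <= 1 by rewrite invf_le1.
have mI := measurable_frac_integrand R alpha k.
have I0 h : (0 <= ((2 - 2 * cos (k%:R * pi * h)) * W h)%:E)%E.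
  by rewrite lee_fin frac_integrand_ge0.
rewrite /frac_symbol (@ge0_integral_itv_split R _ 0 a 1)//; last exact: ltW.
rewrite (_ : Cup * _ = c1 `^ (- s) * (pi ^+ 2 / (3 - s)) * k%:R `^ (2 * alpha - 2) +
  c1 `^ (- s) * (4 / (s - 1)) * k%:R `^ (2 * alpha - 2)); last by rewrite /Cup; ring.
rewrite EFinD; apply: leeD.
  apply: (@le_trans _ _ (\int[leb]_(h in `[0%R, a])
      (((k%:R * pi) ^+ 2 * c1 `^ (- s))%:E * (h `^ (2 - s))%:E))%E).
    apply: ge0_le_integral => //.
    - by apply: measurable_funTS.
    - apply: measurable_funTS; apply: measurable_funeM; apply/measurable_EFinP.
      exact: measurable_powR.
    - move=> h; rewrite /= in_itv/= => /andP[h0 ha]; rewrite -EFinM lee_fin.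
      (* [frac_weight_upper] excludes h = 0, where the factor 2 - 2 cos vanishes. *)
      have [->|hn0] := eqVneq h 0.
        by rewrite mulr0 cos0 mulr1 subrr mul0r mulr_ge0 ?powR_ge0// mulr_ge0 ?powR_ge0 ?sqr_ge0.
      have {}h0 : 0 < h by rewrite lt0r hn0.
      apply: (@le_trans _ _ ((k%:R * pi * h) ^+ 2 * (c1 `^ (- s) * h `^ (- s)))).
        apply: ler_pM; [exact: two_sub_cos_ge0|exact: frac_weight_ge0|exact: two_sub_cos_le|].
        by apply: frac_weight_upper; rewrite h0 (le_trans ha).
      rewrite exprMn powRD ?hn0 ?implybT// powR_mulrn ?(ltW h0)//.
      by rewrite le_eqVlt; apply/orP; left; apply/eqP; ring.
  rewrite ge0_integralZl_EFin//; last 3 first.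
  - by move=> h _; rewrite lee_fin powR_ge0.
  - by apply: measurable_funTS; apply/measurable_EFinP; exact: measurable_powR.
  - by rewrite mulr_ge0 ?sqr_ge0 ?powR_ge0.
  apply: (@le_trans _ _ (((k%:R * pi) ^+ 2 * c1 `^ (- s))%:E *
      (a `^ (2 - s + 1) / (2 - s + 1))%:E)%E).
    apply: lee_wpmul2l; first by rewrite lee_fin mulr_ge0 ?sqr_ge0 ?powR_ge0.
    by apply: integral_powR0_le => //; move: s3; lra.
  rewrite -EFinM lee_fin /a powR_natV.
  rewrite (_ : 2 * alpha - 2 = 2 + - (2 - s + 1)); last by ring.
  have -> : k%:R `^ (2 - (2 - s + 1)) = k%:R ^+ 2 * k%:R `^ (- (2 - s + 1)) :> R.
    by rewrite [LHS]powRD ?powR_mulrn ?(ltW k0')// (gt_eqF k0') implybT.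
  rewrite (_ : 3 - s = 2 - s + 1); last by ring.
  by rewrite le_eqVlt; apply/orP; left; apply/eqP; ring.
apply: (@le_trans _ _ (\int[leb]_(h in `[a, 1%R])
      ((4 * c1 `^ (- s))%:E * (h `^ (- s))%:E))%E).
  apply: ge0_le_integral => //.
  - by apply: measurable_funTS.
  - apply: measurable_funTS; apply: measurable_funeM; apply/measurable_EFinP.
    exact: measurable_powR.
  - move=> h; rewrite /= in_itv/= => /andP[ah h1]; rewrite -EFinM lee_fin -[leRHS]mulrA.
    have h0 : 0 < h by exact: lt_le_trans ah.
    apply: ler_pM; [exact: two_sub_cos_ge0|exact: frac_weight_ge0| |].
    + by have := cos_geN1 (k%:R * pi * h); lra.
    + by apply: frac_weight_upper; rewrite h0.
rewrite ge0_integralZl_EFin//; last 3 first.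
- by move=> h _; rewrite lee_fin powR_ge0.
- by apply: measurable_funTS; apply/measurable_EFinP; exact: measurable_powR.
- by rewrite mulr_ge0 ?powR_ge0.
rewrite integral_powR//; last by rewrite lt_eqF//; move: s1; lra.
rewrite -EFinM lee_fin /a powR_natV powR1.
rewrite (_ : - (- s + 1) = 2 * alpha - 2); last by ring.
set K := k%:R `^ _; rewrite (_ : (1 - K) / (- s + 1) = (K - 1) / (s - 1)); last first.
  rewrite (_ : - s + 1 = - (s - 1)); last by ring.
  by rewrite invrN mulrN -mulNr opprB.
rewrite (_ : c1 `^ (- s) * (4 / (s - 1)) * K = 4 * c1 `^ (- s) * (K / (s - 1))); last by ring.
apply: ler_wpM2l; first by rewrite mulr_ge0 ?powR_ge0.
by rewrite ler_pM2r ?invr_gt0 ?subr_gt0// gerBl.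
Qed.

Lemma frac_symbol_upper_gt0 : 0 < Cup.
Proof.
rewrite mulr_gt0 ?powR_gt0// addr_gt0// divr_gt0 ?subr_gt0// exprn_gt0//.
exact: pi_gt0.
Qed.

End fractional_symbol_bounds.

(** * The two norms on cosine polynomials *)

Section cosine_norm_ell2.
Variable R : realType.

(** Links the supremum defining the norm with the extended series in [cosine_normsq]: each dominates
    all the partial sums of the other. *)
Lemma ell2_eseries (a : ell2 R) :
  (\sum_(0 <= k <oo) (val a k ^+ 2)%:E = (`|a| ^+ 2)%:E)%E.
Proof.
have S n : (\sum_(0 <= k < n) (val a k ^+ 2)%:E = (sqsum R (val a) n)%:E)%E.
  by rewrite sumEFin /sqsum big_mkord.
have a0 k : (0 <= k)%N -> xpredT k -> (0 <= (val a k ^+ 2)%:E)%E.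
  by rewrite lee_fin sqr_ge0.
apply/eqP; rewrite eq_le; apply/andP; split.
  apply: lime_le; first exact: is_cvg_nneseries.
  apply: nearW => n; rewrite S lee_fin -[leLHS]sqr_sqrtr ?sqsum_ge0//.
  by rewrite ler_sqr ?nnegrE ?sqrtr_ge0//; exact: ell2_norm_ub.
have fin : (\sum_(0 <= k <oo) (val a k ^+ 2)%:E)%E \is a fin_num.
  rewrite ge0_fin_numE ?nneseries_ge0//.
  apply: (@le_lt_trans _ _ (`|a| ^+ 2)%:E%E); last exact: ltry.
  apply: lime_le; first exact: is_cvg_nneseries.
  apply: nearW => n; rewrite S lee_fin -[leLHS]sqr_sqrtr ?sqsum_ge0//.
  by rewrite ler_sqr ?nnegrE ?sqrtr_ge0//; exact: ell2_norm_ub.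
rewrite -(fineK fin) lee_fin.
have F0 : 0 <= fine (\sum_(0 <= k <oo) (val a k ^+ 2)%:E)%E by rewrite fine_ge0// nneseries_ge0.
rewrite -[leRHS]sqr_sqrtr// ler_sqr ?nnegrE ?sqrtr_ge0//.
apply: ell2_norm_le => n; rewrite ler_wsqrtr// -lee_fin fineK// -S.
exact: nneseries_lim_ge.
Qed.

Lemma sqsummable_eseries (a : nat -> R) :
  (\sum_(0 <= k <oo) (a k ^+ 2)%:E < +oo)%E -> a \in sqsummable R.
Proof.
move=> aoo; apply/sqsummableP.
exists (Num.sqrt (fine (\sum_(0 <= k <oo) (a k ^+ 2)%:E)%E)) => n.
rewrite ler_wsqrtr// -lee_fin fineK; last first.
  by rewrite ge0_fin_numE ?nneseries_ge0// => k _ _; rewrite lee_fin sqr_ge0.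
rewrite (_ : (sqsum R a n)%:E = (\sum_(0 <= k < n) (a k ^+ 2)%:E)%E).
  by apply: nneseries_lim_ge => k _ _; rewrite lee_fin sqr_ge0.
by rewrite sumEFin /sqsum big_mkord.
Qed.

Variables alpha gamma : R.

Definition cosine_weight (k : nat) : R :=
  if k == 0%N then 1 else gamma^-1 * k%:R `^ alpha.

Definition cosine_seq (f : R -> R) (k : nat) : R := cosine_weight k * cos_coef f k.

Lemma cosine_normsqE (f : R -> R) :
  (cosine_normsq alpha gamma f = \sum_(0 <= k <oo) (cosine_seq f k ^+ 2)%:E)%E.
Proof.
rewrite nneseries_recl//; last by move=> k _; rewrite lee_fin sqr_ge0.
rewrite /cosine_normsq /cosine_seq /cosine_weight/= mul1r; congr (_ + _)%E.
rewrite -nneseriesZl; last by move=> k _; rewrite lee_fin mulr_ge0 ?powR_ge0 ?sqr_ge0.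
rewrite eseries_cond [RHS]eseries_cond.
apply: eq_eseriesr => k /= k0; rewrite gtn_eqF// -EFinM; congr EFin.
rewrite [2 * alpha]mulrC powRrM powR_mulrn ?powR_ge0// !exprMn exprVn; ring.
Qed.

Lemma cosine_seq_sqsummable (f : cosine_space alpha gamma) :
  cosine_seq f \in sqsummable R.
Proof.
apply: sqsummable_eseries; rewrite -cosine_normsqE.
exact: (valP f).
Qed.

Lemma cosine_normE (a : ell2 R) (f : R -> R) : val a = cosine_seq f ->
  cosine_norm alpha gamma f = `|a|.
Proof.
move=> af; rewrite /cosine_norm cosine_normsqE -af ell2_eseries/=.
by rewrite sqrtr_sqr normr_id.
Qed.

Lemma cosine_space_predP (f : L2 R) :
  cosine_seq f \in sqsummable R -> f \in cosine_space_pred alpha gamma.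
Proof.
move=> fs; rewrite unfold_in cosine_normsqE.
by have := ell2_eseries (Ell2 R _ fs); rewrite /= => ->; exact: ltry.
Qed.

End cosine_norm_ell2.

Section cosine_polynomials.
Variable R : realType.
Local Notation leb := (@lebesgue_measure R).
Local Notation pi := (@trigo.pi R).
Local Notation I01 f := (\int[leb]_(x in `[0, 1]) f x).
Implicit Types (n k : nat) (c : nat -> R).

Definition cos_poly n c (x : R) : R := \sum_(k < n) c k * cos_basis k x.

Lemma continuous_cos_basis k : continuous (@cos_basis R k).
Proof.
rewrite /cos_basis; case: (k == 0%N) => x; first exact: cvg_cst.
by apply: cvgM; [exact: cvg_cst|exact: continuous_cosM].
Qed.

Lemma continuous_cos_poly n c : continuous (cos_poly n c).
Proof.
apply: (@continuous_sum R n (fun k x => c k * cos_basis k x)) => k x.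
by apply: cvgM; [exact: cvg_cst|exact: continuous_cos_basis].
Qed.

Lemma cos_basis_orthonormal (j k : nat) :
  I01 (fun x => cos_basis j x * cos_basis k x) = (j == k)%:R.
Proof.
pose w (k : nat) : R := if k == 0%N then 1 else Num.sqrt 2.
have E (i : nat) x : cos_basis i x = w i * cos (i%:R * pi * x).
  by rewrite /cos_basis /w; case: eqP => [->|//]; rewrite !mul0r cos0 mul1r.
rewrite (eq_Rintegral01 R (fun x => (w j * w k) *
  (cos (j%:R * pi * x) * cos (k%:R * pi * x)))); last first.
  by move=> x; rewrite !E; ring.
rewrite Rintegral01Z; last first.
  by move=> x; apply: cvgM; exact: continuous_cosM.
rewrite cos_orthogonal; have [<-|] := eqVneq j k; last by rewrite mul0r mulr0.
rewrite /w; case: eqP => _; first by rewrite !mulr1.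
by rewrite -expr2 sqr_sqrtr// mul1r mulfV.
Qed.

Lemma cos_coef_poly n c k : cos_coef (cos_poly n c) k = if (k < n)%N then c k else 0.
Proof.
pose g (j : nat) x := c j * (cos_basis j x * cos_basis k x).
have cb j : continuous (fun x : R => cos_basis j x * cos_basis k x).
  by move=> x; apply: cvgM; exact: continuous_cos_basis.
rewrite /cos_coef (eq_Rintegral01 R (fun x => \sum_(j < n) g j x)); last first.
  by move=> x; rewrite /cos_poly mulr_suml; apply: eq_bigr => j _; rewrite /g mulrA.
rewrite (@Rintegral01_sum _ _ g); last first.
  by move=> j x; apply: cvgM; [exact: cvg_cst|exact: cb].
rewrite (eq_bigr (fun j : 'I_n => if j == k :> nat then c k else 0)); last first.
  move=> j _; rewrite /g Rintegral01Z// cos_basis_orthonormal.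
  by case: eqP => [->|_]; rewrite ?mulr1 ?mulr0.
rewrite -big_mkcond/=; case: ltnP => [kn|nk].
  by rewrite (big_pred1 (Ordinal kn)).
by rewrite big_pred0// => j; apply/negbTE; rewrite neq_ltn (leq_trans (ltn_ord j) nk).
Qed.

Lemma Rintegral_cos_poly n c : I01 (cos_poly n c) = if (0 < n)%N then c 0%N else 0.
Proof.
rewrite -(cos_coef_poly n c 0) /cos_coef; apply: eq_Rintegral01 => x.
by rewrite /cos_basis eqxx mulr1.
Qed.

Definition deriv_coef c (k : nat) : R := - (Num.sqrt 2 * (k%:R * pi) * c k).

Lemma is_derive_cos_poly n c (x : R) :
  is_derive x 1 (cos_poly n c) (sine_poly R n (deriv_coef c) x).
Proof.
elim: n => [|n IH].
  rewrite /sine_poly big_ord0 (_ : cos_poly 0 c = cst 0).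
    exact: is_derive_cst.
  by apply/funext => y; rewrite /cos_poly big_ord0.
rewrite /sine_poly big_ord_recr/= -/(sine_poly R n (deriv_coef c) x).
rewrite (_ : cos_poly n.+1 c = cos_poly n c + (fun x => c n * cos_basis n x)); last first.
  by apply/funext => y; rewrite /cos_poly big_ord_recr.
apply: is_deriveD.
rewrite /deriv_coef /cos_basis; case: eqP => [->|_].
  rewrite !mul0r mulr0 mul0r oppr0 mul0r (_ : (fun _ => _) = cst (c 0%N)).
    exact: is_derive_cst.
  by apply/funext => y; rewrite mulr1.
have := is_deriveZ (c n * Num.sqrt 2) (is_derive_cosM R (n%:R * pi) x).
rewrite /GRing.scale/=.
rewrite (_ : c n * _ * _ = - (Num.sqrt 2 * (n%:R * pi) * c n) * sin (n%:R * pi * x)); last by ring.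
congr is_derive; apply/funext => y /=.
by rewrite /GRing.scale/= mulrA.
Qed.

Lemma derive_cos_poly n c : (cos_poly n c)^`()%classic = sine_poly R n (deriv_coef c).
Proof.
by apply/funext => x; rewrite derive1E; have [] := is_derive_cos_poly n c x.
Qed.

Variable alpha : R.
Hypothesis halpha : 1 < alpha < 2.

Let K : R := (alpha - 1) * (2 - alpha) * pi ^+ 3 / 8.

(* The factor [2] is the square of the normalization [sqrt 2] of the basis. *)
Definition sob_eigen (k : nat) : R :=
  (k%:R * pi) ^+ 2 * (1 + 2 * K * fine (frac_symbol R alpha k)).

(** The upper bound settles k > 0; at k = 0 the integrand is identically zero. *)
Lemma frac_symbol_fin_num k : frac_symbol R alpha k \is a fin_num.
Proof.
rewrite ge0_fin_numE ?frac_symbol_ge0//.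
case: k => [|k]; last by apply: le_lt_trans (frac_symbol_upper _ _ halpha k.+1 _) (ltry _).
rewrite /frac_symbol integral0_eq ?ltry// => h _.
by rewrite !mul0r cos0 mulr1 subrr mul0r.
Qed.

Lemma sob_inner_cos_poly gamma n c :
  sob_inner alpha gamma (cos_poly n c) (cos_poly n c) =
  (if (0 < n)%N then c 0%N else 0) ^+ 2 +
  gamma ^- 2 * \sum_(k < n) sob_eigen k * c k ^+ 2.
Proof.
rewrite /sob_inner Rintegral_cos_poly -expr2 derive_cos_poly; congr (_ + _ * _).
set b := deriv_coef c.
rewrite (eq_Rintegral01 R (fun x => (sine_poly R n b x) ^+ 2)); last by move=> x; rewrite expr2.
rewrite (@Rintegral01_sqr_sum R n (fun k x => sin (k%:R * pi * x))
  (fun k => if k == 0%N then 0 else 2^-1) b); last 2 first.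
- by move=> k; exact: continuous_sinM.
- exact: sin_orthogonal.
rewrite /frac_form {1}/Rintegral integral_frac_sine_poly.
(* Finiteness of every symbol lets [fine] pass through the sum; an infinite term would be turned
   into 0. *)
have -> : fine (\sum_(k < n) (b k ^+ 2)%:E * frac_symbol R alpha k)%E =
    \sum_(k < n) b k ^+ 2 * fine (frac_symbol R alpha k).
  rewrite -sum_fine => [|k _]; last by rewrite fin_numM// frac_symbol_fin_num.
  by apply: eq_bigr => k _; rewrite fineM// frac_symbol_fin_num.
rewrite -/K mulr_sumr -big_split/=; apply: eq_bigr => k _.
rewrite /sob_eigen /b /deriv_coef sqrrN !exprMn sqr_sqrtr//.
case: eqP => [->|_]; first by rewrite expr0n/= !mul0r mulr0 !mul0r mulr0 addr0.
by field.
Qed.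

(** With A = k^(2 alpha - 2), the square of k^alpha is k^2 A. The lower bound drops the 1 in the
    eigenvalue, the upper bound absorbs it using A >= 1. *)
Lemma sob_eigen_bounds : exists m M : R, [/\ 0 < m, m <= M &
  forall k, (0 < k)%N ->
    m * k%:R `^ alpha <= Num.sqrt (sob_eigen k) <= M * k%:R `^ alpha].
Proof.
have /andP[a1 a2] := halpha; have p0 := pi_gt0 R.
have K0 : 0 < K.
  rewrite /K divr_gt0// mulr_gt0 ?exprn_gt0//.
  by rewrite mulr_gt0 ?subr_gt0.
set cl := (pi / 2) `^ (- (2 * alpha - 1)).
have cl0 : 0 < cl by rewrite powR_gt0// divr_gt0.
have up := frac_symbol_upper _ _ halpha; have Cup0 := frac_symbol_upper_gt0 _ _ halpha.
set Cup := (X in 0 < X) in Cup0.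
pose m := pi * Num.sqrt (2 * K * cl); pose M := pi * Num.sqrt (1 + 2 * K * Cup).
have K2 : 0 < 2 * K := mulr_gt0 (ltr0Sn R 1) K0.
have Kcl : 0 < 2 * K * cl := mulr_gt0 K2 cl0.
have KCup : 0 < 2 * K * Cup := mulr_gt0 K2 Cup0.
have m0 : 0 < m by apply: mulr_gt0 => //; rewrite sqrtr_gt0.
have key k : (0 < k)%N -> m * k%:R `^ alpha <= Num.sqrt (sob_eigen k) <= M * k%:R `^ alpha.
  move=> k0; set J := fine (frac_symbol R alpha k).
  have k1 : 1 <= k%:R :> R by rewrite ler1n.
  set A := k%:R `^ (2 * alpha - 2).
  have Jl : cl * A <= J.
    by rewrite -lee_fin fineK ?frac_symbol_fin_num//; exact: frac_symbol_lower.
  have Ju : J <= Cup * A by rewrite -lee_fin fineK ?frac_symbol_fin_num//; exact: up.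
  have A1 : 1 <= A by rewrite -(powRr0 k%:R) ler_powR//; lra.
  have P0 : 0 <= k%:R `^ alpha by exact: powR_ge0.
  have kA : (k%:R `^ alpha) ^+ 2 = k%:R ^+ 2 * A.
    rewrite -powR_mulrn ?powR_ge0// -powRrM -(@powR_mulrn _ k%:R)//.
    rewrite -[RHS]powRD; first by congr powR; ring.
    by rewrite pnatr_eq0 gtn_eqF// implybT.
  have sE (x y : R) : 0 <= y -> pi * Num.sqrt y * k%:R `^ alpha =
      Num.sqrt ((k%:R * pi) ^+ 2 * (y * A)).
    move=> y0; have -> : (k%:R * pi) ^+ 2 * (y * A) = (pi * k%:R `^ alpha) ^+ 2 * y.
      by rewrite !exprMn kA; ring.
    rewrite sqrtrM ?sqr_ge0// sqrtr_sqr ger0_norm ?mulr_ge0// ?ltW//; ring.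
  rewrite /m /M !sE ?(ltW Kcl) ?addr_ge0 ?(ltW KCup)//.
  rewrite !ler_wsqrtr//= /sob_eigen -/J ler_wpM2l ?sqr_ge0//.
  - have := ler_wpM2l (ltW K2) Ju; nra.
  - have := ler_wpM2l (ltW K2) Jl; nra.
exists m, M; split=> //.
(* At k = 1 the power is 1, so the two bounds compare m with M. *)
by have /andP[h1 h2] := key 1%N isT; have := le_trans h1 h2; rewrite powR1 !mulr1.
Qed.

End cosine_polynomials.

(** * Completeness of the cosine system *)

Section cosine_uniqueness.
Variable R : realType.
Local Notation leb := (@lebesgue_measure R).
Local Notation mu := (unit_measure R).
Local Notation pi := (@trigo.pi R).
Local Notation I01 f := (\int[leb]_(x in `[0, 1]) f x).

Lemma L2_measurable (f : L2 R) :
  measurable_fun setT (f : measurableTypeR R -> measurableTypeR R).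
Proof.
exact: (@measurable_funPT _ _ (measurableTypeR R) (measurableTypeR R)
  (repr (LebesgueSpace.sort f))).
Qed.

Lemma L2_integrable01 (f : L2 R) : leb.-integrable `[0, 1] (EFin \o f).
Proof.
have mf := L2_measurable f.
have m01 : measurable (`[0, 1]%classic : set (measurableTypeR R)) by exact: measurable_itv.
have fi : mu.-integrable setT (EFin \o f).
  apply/Lfun1_integrable; apply: Lfun_subset12; first by rewrite unit_measureT.
  exact: L2_Lfun.
apply/integrableP; split; first by apply: measurable_funTS; exact/measurable_EFinP.
have /integrableP[_] := fi; apply: le_lt_trans.
rewrite (@eq_measure_integral _ _ _ _ mu); last first.
  by move=> A mA A01; rewrite /unit_measure/= /mrestr setIidl.
apply: ge0_subset_integral => //.
by do 2 apply: measurableT_comp => //.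
Qed.

Section vanishing_moments.
Variable f : L2 R.
Hypothesis f0 : forall k, cos_coef f k = 0.

Lemma integrable01_mul_bounded (h : R -> R) (M : R) :
  measurable_fun setT (h : measurableTypeR R -> measurableTypeR R) ->
  (forall x, `|h x| <= M) -> leb.-integrable `[0, 1] (EFin \o (fun x => f x * h x)).
Proof.
move=> mh hM; have fi := L2_integrable01 f.
have M0 : 0 <= M by apply: le_trans (hM 0).
have fMi : leb.-integrable `[0, 1] (fun x => M%:E * (EFin \o f) x)%E.
  exact: integrableZl.
apply: le_integrable fMi => //.
- apply/measurable_EFinP; apply: measurable_funTS; apply: measurable_funM => //.
  exact: L2_measurable.
- move=> x _; rewrite -EFinM lee_fin !normrM mulrC ler_wpM2r//.
  by rewrite (ger0_norm M0).
Qed.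

Lemma Rintegral_mul_cos (k : nat) : I01 (fun x => f x * cos (k%:R * pi * x)) = 0.
Proof.
have := f0 k; rewrite /cos_coef /cos_basis; case: eqP => [-> h|_ h].
  rewrite -[RHS]h; apply: eq_Rintegral01 => x.
  by rewrite !mul0r cos0.
have s2 : Num.sqrt 2 != 0 :> R by rewrite gt_eqF// sqrtr_gt0.
apply: (mulfI s2); rewrite mulr0 -[RHS]h -RintegralZl//; last first.
  apply: (integrable01_mul_bounded _ 1) => [|x]; last exact: cos_max.
  by apply: continuous_measurable_fun; exact: continuous_cosM.
by apply: eq_Rintegral01 => x; rewrite mulrCA.
Qed.

Lemma horner_bounded (p : {poly R}) : exists M, forall y, `|y| <= 1 -> `|p.[y]| <= M.
Proof.
elim/poly_ind: p => [|p c [M pM]]; first by exists 0 => y _; rewrite horner0 normr0.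
exists (M + `|c|) => y y1; rewrite !hornerE.
apply: le_trans (ler_normD _ _) _; rewrite lerD2r normrM.
have := pM y y1; have := normr_ge0 p.[y]; nra.
Qed.

Lemma continuous_horner_cos (p : {poly R}) (k : nat) :
  continuous (fun x => p.[cos (pi * x)] * cos (k%:R * pi * x)).
Proof.
move=> x; apply: cvgM; last exact: continuous_cosM.
apply: (@continuous_comp _ _ _ (fun x => cos (pi * x)) (horner p)).
  exact: continuous_cosM.
exact: continuous_horner.
Qed.

Lemma integrable01_horner_cos (p : {poly R}) (k : nat) : leb.-integrable `[0, 1]
  (EFin \o (fun x => f x * (p.[cos (pi * x)] * cos (k%:R * pi * x)))).
Proof.
have [M pM] := horner_bounded p.
apply: (integrable01_mul_bounded _ M) => [|x].
  by apply: continuous_measurable_fun; exact: continuous_horner_cos.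
rewrite normrM; have := pM _ (cos_max (pi * x)); have := cos_max (k%:R * pi * x).
have := normr_ge0 p.[cos (pi * x)]; have := normr_ge0 (cos (k%:R * pi * x)); nra.
Qed.

(** The additional factor cos(k pi x) makes the induction on p work: multiplying p by its variable
    turns cos(k pi x) into the half-sum of its neighbours of indices k - 1 and k + 1. *)
Lemma Rintegral_mul_horner_cos (p : {poly R}) (k : nat) :
  I01 (fun x => f x * (p.[cos (pi * x)] * cos (k%:R * pi * x))) = 0.
Proof.
pose I (p : {poly R}) (k : nat) x := f x * (p.[cos (pi * x)] * cos (k%:R * pi * x)).
have iI (q : {poly R}) (j : nat) : leb.-integrable `[0, 1] (EFin \o I q j).
  exact: integrable01_horner_cos.
have iZ (a : R) (q : {poly R}) (j : nat) : leb.-integrable `[0, 1] (EFin \o (fun x => a * I q j x)).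
  rewrite (_ : EFin \o _ = (fun x : measurableTypeR R => a%:E * (EFin \o I q j) x)%E)//.
  exact: integrableZl.
elim/poly_ind: p k => [|p c IH] k.
  rewrite (eq_Rintegral01 _ (cst 0)) ?Rintegral01_cst// => x.
  by rewrite horner0 mul0r mulr0.
have c1 : I01 (fun x => c * I 1 k x) = 0.
  rewrite RintegralZl// (eq_Rintegral01 _ (fun x => f x * cos (k%:R * pi * x))).
    by rewrite Rintegral_mul_cos mulr0.
  by move=> x; rewrite /I hornerC mul1r.
(* For k = 0 there is no index k - 1; the product with cos(pi x) is directly the case k = 1. *)
case: k c1 => [|k] c1.
  rewrite (eq_Rintegral01 _ (fun x => I p 1%N x + c * I 1 0%N x)); last first.
    by move=> x; rewrite /I hornerMXaddC hornerC !mul0r cos0 !mul1r; ring.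
  by rewrite RintegralD// c1 IH addr0.
rewrite (eq_Rintegral01 _ (fun x =>
    (2^-1 * I p k x + 2^-1 * I p k.+2 x) + c * I 1 k.+1 x)); last first.
  move=> x; rewrite /I hornerMXaddC hornerC.
  have -> : cos (k%:R * pi * x) = cos (k.+1%:R * pi * x - pi * x).
    by congr cos; rewrite -natr1; ring.
  have -> : cos (k.+2%:R * pi * x) = cos (k.+1%:R * pi * x + pi * x).
    by congr cos; rewrite -natr1; ring.
  by rewrite cosB cosD; field.
have i2 : leb.-integrable `[0, 1] (EFin \o (fun x => 2^-1 * I p k x + 2^-1 * I p k.+2 x)).
  exact: (@integrableD _ (measurableTypeR R) R leb _ (measurable_itv `[0, 1]) _ _
    (iZ 2^-1 p k) (iZ 2^-1 p k.+2)).
by rewrite RintegralD// c1 addr0 RintegralD// !RintegralZl// !IH !mulr0 addr0.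
Qed.


Lemma bernoulli_sub (v : R) (m : nat) : 0 <= v <= 1 -> 1 - m%:R * v <= (1 - v) ^+ m.
Proof.
move=> /andP[v0 v1]; elim: m => [|m IH]; first by rewrite mul0r subr0 expr0.
rewrite exprSr; apply: (@le_trans _ _ ((1 - m%:R * v) * (1 - v))).
  rewrite -natr1; have : 0 <= m%:R * v ^+ 2 by rewrite mulr_ge0 ?sqr_ge0.
  by nra.
by rewrite ler_wpM2r// subr_ge0.
Qed.

(** From m v <= (1 + v)^m and (1 - v^2)^m <= 1. *)
Lemma bernoulli_mul (v : R) (m : nat) : 0 <= v <= 1 -> (1 - v) ^+ m * (m%:R * v) <= 1.
Proof.
move=> /andP[v0 v1].
have B : m%:R * v <= (1 + v) ^+ m.
  apply: (@le_trans _ _ (1 + m%:R * v)); first by rewrite lerDr.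
  elim: m => [|m IH]; first by rewrite mul0r addr0 expr0.
  rewrite exprSr; apply: (@le_trans _ _ ((1 + m%:R * v) * (1 + v))).
    rewrite -natr1; have : 0 <= m%:R * v ^+ 2 by rewrite mulr_ge0 ?sqr_ge0.
    by nra.
  by rewrite ler_wpM2r// addr_ge0.
apply: (@le_trans _ _ ((1 - v) ^+ m * (1 + v) ^+ m)).
  by rewrite ler_wpM2l// exprn_ge0// subr_ge0.
rewrite -exprMn exprn_ile1//; nra.
Qed.

(* Tends boundedly to the indicator of [u < 1/2] on [0, 1].  Taking [u] affine in
   [cos (pi x)] yields the indicators of the intervals [0, t] as bounded limits
   of polynomials in [cos (pi x)], so that the Weierstrass theorem is not needed. *)
Definition step_approx (n : nat) (u : R) : R := (1 - u ^+ n) ^+ (2 ^ n).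

Lemma step_approx_bounds n u : 0 <= u <= 1 -> 0 <= step_approx n u <= 1.
Proof.
move=> /andP[u0 u1]; have U0 : 0 <= u ^+ n by rewrite exprn_ge0.
have U1 : u ^+ n <= 1 by rewrite exprn_ile1.
by rewrite exprn_ge0 ?subr_ge0//= exprn_ile1 ?subr_ge0// gerBl.
Qed.

(** Bernoulli's inequality with v = u^n and exponent 2^n gives the lower bound 1 - (2 u)^n, and 2 u
    < 1. *)
Lemma step_approx_lt u : 0 <= u -> u < 2^-1 -> step_approx n u @[n --> \oo] --> (1 : R).
Proof.
move=> u0 u2; apply: (@squeeze_cvgr _ _ _ _ (fun n => 1 - (2 * u) ^+ n) (cst 1)).
- apply: nearW => n; have U0 : 0 <= u ^+ n by rewrite exprn_ge0.
  have U1 : u ^+ n <= 1 by rewrite exprn_ile1//; lra.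
  have u01 : 0 <= u <= 1 by apply/andP; split; lra.
  have /andP[_ ->] := step_approx_bounds n _ u01; rewrite andbT.
  rewrite exprMn -natrX; apply: bernoulli_sub.
  by rewrite U0.
- rewrite -[X in _ --> X]subr0; apply: cvgB; first exact: cvg_cst.
  by apply: cvg_expr; rewrite ger0_norm; lra.
- exact: cvg_cst.
Qed.

(** [bernoulli_mul] with v = u^n and exponent 2^n gives the upper bound (2 u)^-n, and 2 u > 1. *)
Lemma step_approx_gt u : 2^-1 < u -> u <= 1 -> step_approx n u @[n --> \oo] --> (0 : R).
Proof.
move=> u2 u1; have u20 : 0 < 2 * u by lra.
apply: (@squeeze_cvgr _ _ _ _ (cst 0) (fun n => ((2 * u)^-1) ^+ n)).
- apply: nearW => n; have U0 : 0 <= u ^+ n by rewrite exprn_ge0//; lra.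
  have U1 : u ^+ n <= 1 by rewrite exprn_ile1//; lra.
  have u01 : 0 <= u <= 1 by apply/andP; split; lra.
  have /andP[-> _] := step_approx_bounds n _ u01 => /=.
  rewrite exprVn -[leRHS]mul1r ler_pdivlMr ?exprn_gt0//.
  by rewrite exprMn -natrX; apply: bernoulli_mul; rewrite U0.
- exact: cvg_cst.
- apply: cvg_expr; rewrite ger0_norm ?invr_ge0 ?ltW// invf_lt1//; lra.
Qed.

Lemma Rintegral_prefix_eq0 (t : R) : 0 <= t <= 1 ->
  (\int[leb]_(x in `[0%R, t]) (f x)%:E = 0)%E.
Proof.
move=> t01; have /andP[t0 t1] := t01; have p0 := pi_gt0 R.
(* Cosine decreases on [0, pi], so on [0, 1] this u crosses 1/2 upwards exactly at x = t; the factor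
   1/4 keeps it within [0, 1]. *)
pose u x : R := 2^-1 + cos (pi * t) / 4 - cos (pi * x) / 4.
have u01 x : 0 <= u x <= 1.
  rewrite /u; have := cos_geN1 (pi * x); have := cos_le1 (pi * x).
  have := cos_geN1 (pi * t); have := cos_le1 (pi * t).
  by move=> *; apply/andP; split; lra.
pose P n : {poly R} := (1 - ((2^-1 + cos (pi * t) / 4)%:P - 4^-1 *: 'X) ^+ n) ^+ (2 ^ n).
have PE n x : (P n).[cos (pi * x)] = step_approx n (u x).
  rewrite /P /step_approx /u horner_exp hornerD hornerN hornerC horner_exp.
  rewrite hornerD hornerN hornerC hornerZ hornerX.
  by rewrite [cos (pi * x) / 4]mulrC.
have mf : measurable_fun (`[0, 1] : set (measurableTypeR R)) (EFin \o f).
  by apply: measurable_funTS; apply/measurable_EFinP; exact: L2_measurable.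
have [|||||_ _ cv] := @dominated_convergence _ (measurableTypeR R) R leb `[0, 1] (measurable_itv _)
  (fun n x => (f x * step_approx n (u x))%:E) ((EFin \o f) \_ `[0, t])
  (fun x => `|(EFin \o f) x|%E).
- move=> n; apply/measurable_EFinP; apply: measurable_funM.
    by apply: measurable_funTS; exact: L2_measurable.
  rewrite (_ : (fun x => _) = (fun x => (P n).[cos (pi * x)] * cos (0%:R * pi * x))); last first.
    by apply/funext => x; rewrite PE !mul0r cos0 mulr1.
  apply: measurable_funTS; apply: continuous_measurable_fun.
  exact: continuous_horner_cos.
- apply: measurable_funTS; apply/(measurable_restrictT _ _).1 => //.
  by apply: measurable_funTS; apply/measurable_EFinP; exact: L2_measurable.
(* The step approximants have no prescribed limit at the crossing point, a null set. *)
- exists [set t]; split => //; first exact: lebesgue_measure_set1.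
  move=> x /= nx; apply: contrapT => /eqP xt; apply: nx; rewrite /= in_itv/= => /andP[x0 x1].
  have itv_pi y : 0 <= y -> y <= 1 -> pi * y \in `[0, pi].
    by move=> y0 y1; rewrite in_itv/= mulr_ge0 ?(ltW p0)//= ler_piMr// ltW.
  have cmp y z : 0 <= y -> y <= 1 -> 0 <= z -> z <= 1 -> y < z -> cos (pi * z) < cos (pi * y).
    by move=> *; rewrite ltr_cos ?itv_pi// ltr_pM2l.
  have /andP[ux0 ux1] := u01 x.
  rewrite patchE; have [tx|xt'|] := ltgtP t x; last by move=> tx; rewrite tx eqxx in xt.
    rewrite memNset; last by rewrite /= in_itv/= => /andP[_]; rewrite leNgt tx.
    apply/cvg_EFin; first exact: nearW.
    rewrite /comp/= -[X in _ --> X](mulr0 (f x)); apply: cvgM; first exact: cvg_cst.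
    by apply: step_approx_gt => //; have := cmp _ _ t0 t1 x0 x1 tx; rewrite /u; lra.
  rewrite mem_set/=; last by rewrite /= in_itv/= x0 ltW.
  apply/cvg_EFin; first exact: nearW.
  rewrite /comp/= -[X in _ --> X](mulr1 (f x)); apply: cvgM; first exact: cvg_cst.
  by apply: step_approx_lt => //; have := cmp _ _ x0 x1 t0 t1 xt'; rewrite /u; lra.
- exact/integrable_abse/L2_integrable01.
- apply: aeW => x n _; rewrite /= lee_fin normrM ler_piMr//.
  by have /andP[h0 h1] := step_approx_bounds n _ (u01 x); rewrite ger0_norm.
move: cv; rewrite -integral_mkcondr (_ : _ `&` _ = `[0, t]%classic); last first.
  apply/seteqP; split => x /=; rewrite !in_itv/=; first by case.
  by move=> /andP[-> xt]; rewrite xt (le_trans xt t1).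
rewrite (_ : (fun n => _) = cst 0%E); last first.
  apply/funext => n /=; rewrite -[LHS]fineK; last first.
    apply: integrable_fin_num => //.
    have := integrable01_horner_cos (P n) 0.
    by congr (_.-integrable _ _); apply/funext => x /=; rewrite PE !mul0r cos0 mulr1.
  congr EFin; rewrite -[RHS](Rintegral_mul_horner_cos (P n) 0); congr fine.
  by apply: eq_integral => x _; rewrite PE !mul0r cos0 mulr1.
by move=> /cvg_unique-/(_ (@ereal_hausdorff R) _ (cvg_cst _)).
Qed.

(** The primitive of f vanishes on all of [0, 1], and by Lebesgue differentiation f is almost
    everywhere the derivative of that primitive. *)
Lemma cos_coef_eq0 : f = 0.
Proof.
pose g := (f : R -> R) \_ `[0, 1].
have ig : leb.-integrable setT (EFin \o g).
  rewrite /g -restrict_EFin; apply/(integrable_mkcond _ _).1 => //.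
  exact: L2_integrable01.
have F0 t : 0 <= t <= 1 -> \int[leb]_(x in `[0, t]) g x = 0.
  move=> t01; rewrite /Rintegral -[RHS]/(fine 0%E) -(Rintegral_prefix_eq0 _ t01).
  congr fine; apply: eq_integral => x; rewrite inE/= in_itv/= => /andP[x0 xt].
  rewrite /g patchE mem_set//= in_itv/= x0 (le_trans xt)//.
  by case/andP: t01.
have gl : locally_integrable [set: R] g.
  have := @integrable_locally R g setT measurableT ig.
  by rewrite patch_setT.
have gi y : leb.-integrable [set` Interval (BLeft 0) (BRight y)] (EFin \o g).
  by apply: integrableS ig => //; exact: measurable_itv.
have [N [mN N0 subN]] := @FTC1 R g (BLeft 0) gi gl.
apply/L2_eqP; apply: (@ae_eq_trans _ _ _ mu _ _ _ (cst 0)); last first.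
  exact/ae_eq_sym/(L2_classE 0).
have mu_null (A : set R) : measurable A -> leb (A `&` `[0, 1]) = 0%E -> mu.-negligible A.
  by move=> mA A0; exists A; split.
(* The endpoints join the exceptional set, because the primitive must vanish on a full neighbourhood
   of the point. *)
have NN : mu.-negligible (N `|` (~` `]0, 1[)).
  apply: negligibleU.
    apply: mu_null => //; apply/eqP; rewrite -measure_le0 -N0.
    by apply: le_measure; rewrite ?inE//; exact: measurableI.
  apply: mu_null; first exact: measurableC.
  rewrite (_ : _ `&` _ = [set 0] `|` [set 1]); last first.
    apply/seteqP; split => x /=; rewrite !in_itv/=.
      move=> [h /andP[x0 x1]].
      have [->|x0'] := eqVneq x 0; first by left.
      right; apply/eqP; rewrite eq_le x1/= leNgt; apply/negP => x1'; apply: h.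
      by rewrite lt0r x0' x0.
    by move=> [|] ->; rewrite ?lexx ?ltxx ?ler01 ?andbF.
  by apply: null_set_setU;
    [exact: measurable_set1|exact: measurable_set1|
     exact: lebesgue_measure_set1|exact: lebesgue_measure_set1].
apply: negligibleS NN => x /= fx.
have [x01|] := pselect (`]0, 1[%classic x); last by right.
left; apply: subN => /= h; apply: fx => _.
move: x01; rewrite /= in_itv/= => /andP[x0 x1].
have [|dF Fx] := h; first by rewrite lte_fin.
rewrite (_ : f x = g x); last by rewrite /g patchE mem_set//= in_itv/= (ltW x0) (ltW x1).
rewrite -Fx derive1E (@near_eq_derive _ _ _ _ (cst 0)) ?derive_cst//.
near=> y; apply: F0; apply/andP.
by split; apply: ltW; near: y; [exact: lt_nbhsr|exact: lt_nbhsl].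
Unshelve. all: by end_near. Qed.

End vanishing_moments.

End cosine_uniqueness.

(** * Absolutely convergent cosine series *)

Section cosine_synthesis.
Variable R : realType.
Local Notation leb := (@lebesgue_measure R).
Local Notation mu := (unit_measure R).
Local Notation I01 f := (\int[leb]_(x in `[0, 1]) f x).

Lemma bounded_Lfun2 (g : R -> R) (B : R) :
  measurable_fun setT (g : measurableTypeR R -> measurableTypeR R) ->
  (forall x, `|g x| <= B) -> (g : measurableTypeR R -> R) \in Lfun mu 2%:E.
Proof.
move=> mg gB; apply/andP; split; rewrite inE//= /finite_norm unlock.
apply: poweR_lty; apply: (@le_lt_trans _ _ (\int[mu]_x (B ^+ 2)%:E)%E).
  apply: ge0_le_integral => //.
  - by move=> x _; exact: poweR_ge0.
  - apply/measurable_EFinP; apply: (@measurableT_comp _ _ _ _ _ _ (@powR R ^~ 2)) => //.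
    exact: measurableT_comp.
  - move=> x _; rewrite /= lee_fin powR_mulrn//.
    by rewrite ler_sqr ?nnegrE// (le_trans _ (gB x)).
by rewrite integral_cst//= unit_measureT mule1 ltry.
Qed.

Lemma L2_of_bounded (g : R -> R) (B : R) :
  measurable_fun setT (g : measurableTypeR R -> measurableTypeR R) ->
  (forall x, `|g x| <= B) ->
  exists2 f : L2 R, (f : R -> R) = g %[ae mu] & forall k, cos_coef f k = cos_coef g k.
Proof.
move=> mg gB; exists (L2_class (Lfun_Sub (lee1n 2) (bounded_Lfun2 _ _ mg gB))).
  exact: L2_classE.
move=> k; set f := L2_class _.
have fg : (f : R -> R) = g %[ae mu] by exact: L2_classE.
have mL : measurable_fun setT (fun x => f x * cos_basis k x).
  by have /measurable_EFinP := measurable_int _ (integrable_cos f k).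
have mR : measurable_fun setT (fun x => g x * cos_basis k x).
  by apply: measurable_funM => //; exact: measurable_cos_basis.
rewrite /cos_coef !Rintegral01E//; congr fine; apply: ae_eq_integral => //.
- exact/measurable_EFinP.
- exact/measurable_EFinP.
- have := @ae_eq_comp2 _ _ R mu setT R (\bar R)
    (fun x y => (y * cos_basis k x)%:E) _ _ fg.
  by congr ae_eq.
Qed.

(** The basis is bounded by 2, so the series converges absolutely at every point with partial sums
    at most 2 M. Dominated convergence passes the k-th coefficient to the limit, where the
    coefficients of the partial sums are eventually a_k. *)
Lemma cos_series (a : nat -> R) (M : R) : (forall n, \sum_(k < n) `|a k| <= M) ->
  exists f : L2 R, forall k, cos_coef f k = a k.
Proof.
move=> aM.
have polyM n x : `|cos_poly R n a x| <= M * 2.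
  apply: le_trans (ler_norm_sum _ _ _) _.
  apply: (@le_trans _ _ (\sum_(k < n) `|a k| * 2)).
    by apply: ler_sum => k _; rewrite normrM ler_wpM2l// cos_basis_bounded.
  by rewrite -mulr_suml ler_wpM2r.
have cv x : cvgn (fun n => cos_poly R n a x).
  have -> : (fun n => cos_poly R n a x) = series (fun k => a k * cos_basis k x).
    by apply/funext => n; rewrite /series/= big_mkord.
  apply: normed_cvg; apply: nondecreasing_is_cvgn.
    by apply/nondecreasing_seqP => n; rewrite [leRHS]seriesSr lerDl; exact: normr_ge0.
  exists (M * 2) => _ [n _ <-].
  rewrite [leLHS](_ : _ = \sum_(k < n) `|a k * cos_basis k x|); last exact: big_mkord.
  apply: (@le_trans _ _ (\sum_(k < n) `|a k| * 2)).
    by apply: ler_sum => k _; rewrite normrM ler_wpM2l// cos_basis_bounded.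
  by rewrite -mulr_suml ler_wpM2r.
pose g x := limn (fun n => cos_poly R n a x).
have mp n : measurable_fun setT (cos_poly R n a : measurableTypeR R -> measurableTypeR R).
  by apply: continuous_measurable_fun; exact: continuous_cos_poly.
have mg : measurable_fun setT (g : measurableTypeR R -> measurableTypeR R).
  by apply: (measurable_fun_cvg mp) => x _; exact: cv.
have gM x : `|g x| <= M * 2.
  rewrite -lim_norm//; apply: limr_le; first exact: is_cvg_norm.
  exact: nearW.
have [f _ fg] := L2_of_bounded g _ mg gM.
exists f => k; rewrite fg.
have [|||||_ _ h] := @dominated_convergence _ (measurableTypeR R) R leb `[0, 1] (measurable_itv _)
  (fun n x => (cos_poly R n a x * cos_basis k x)%:E) (fun x => (g x * cos_basis k x)%:E)
  (cst (M * 2 * 2)%:E).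
- move=> n; apply: measurable_funTS; apply/measurable_EFinP.
  by apply: measurable_funM; [exact: mp|exact: measurable_cos_basis].
- apply: measurable_funTS; apply/measurable_EFinP.
  by apply: measurable_funM; [exact: mg|exact: measurable_cos_basis].
- apply: aeW => x _; apply/cvg_EFin; first exact: nearW.
  by apply: cvgM; [exact: cv|exact: cvg_cst].
- have := @continuous_integrable01 R (cst (M * 2 * 2)) (fun x => cvg_cst _ ).
  exact.
- apply: aeW => x n _; rewrite /= lee_fin normrM ler_pM// ?cos_basis_bounded//.
have ak : (\int[leb]_(x in `[0%R, 1%R]) (cos_poly R n a x * cos_basis k x)%:E)%E
    @[n --> \oo] --> (a k)%:E.
  apply: cvg_near_cst; near=> n.
  rewrite -[LHS]fineK; last first.
    apply: integrable_fin_num => //; apply: continuous_integrable01 => x.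
    by apply: cvgM; [exact: continuous_cos_poly|exact: continuous_cos_basis].
  rewrite -[fine _]/(cos_coef (cos_poly R n a) k) cos_coef_poly.
  by rewrite (_ : (k < n)%N)//; near: n; exact: nbhs_infty_gt.
by rewrite /cos_coef /Rintegral (cvg_unique (@ereal_hausdorff R) h ak).
Unshelve. all: by end_near. Qed.

(** The term k = 0 is 0 by the convention for inverses. The induction needs the sharper 2 - 1/(m +
    1), since (x + 1)^-2 is at most x^-1 - (x + 1)^-1. *)
Lemma sum_inv_sqr_le (n : nat) : \sum_(k < n) (k%:R ^- 2 : R) <= 2.
Proof.
suff H m : \sum_(k < m.+2) (k%:R ^- 2 : R) <= 2 - m.+1%:R^-1.
  case: n => [|[|n]]; first by rewrite big_ord0.
    by rewrite big_ord_recr big_ord0/= expr0n/= invr0 add0r.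
  by apply: le_trans (H n) _; rewrite gerBl.
elim: m => [|m IH].
  by rewrite !big_ord_recr big_ord0/= expr0n/= invr0 !add0r expr1n invr1; lra.
rewrite big_ord_recr/=; apply: le_trans (lerD IH (lexx _)) _.
have n0 : 0 < m.+1%:R :> R by [].
have E : m.+2%:R = m.+1%:R + 1 :> R by rewrite natr1.
rewrite E; move: (m.+1%:R : R) n0 => x x0.
have x1 : 0 < x + 1 by rewrite addr_gt0.
rewrite -subr_ge0.
have -> : 2 - (x + 1)^-1 - (2 - x^-1 + (x + 1) ^- 2) = ((x + 1)^-1) ^+ 2 * x^-1.
  by field; rewrite ?gt_eqF.
by rewrite mulr_ge0 ?sqr_ge0// invr_ge0 ltW.
Qed.

End cosine_synthesis.

(** * The isomorphism *)

Section cosine_polynomial_space.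
Variable R : realType.
Local Notation mu := (unit_measure R).

Lemma cos_poly_cos_coef n (c : nat -> R) (N : nat) : (n <= N)%N ->
  cos_poly R n c = cos_poly R N (cos_coef (cos_poly R n c)).
Proof.
move=> nN; apply/funext => x; rewrite /cos_poly.
rewrite (big_ord_widen _ (fun k => c k * cos_basis k x) nN) big_mkcond/=.
by apply: eq_bigr => k _; rewrite -/(cos_poly R n c) cos_coef_poly;
  case: ltnP => // _; rewrite mul0r.
Qed.

(** A canonical form for the existentially quantified length and coefficients: two polynomials can
    be written with one common length. *)
Lemma cos_polys_cos_coef (p : R -> R) : cos_polys p ->
  exists n, forall N, (n <= N)%N -> p = cos_poly R N (cos_coef p).
Proof. by move=> [n [c ->]]; exists n => N nN; exact: cos_poly_cos_coef. Qed.

Lemma cos_polys_lin (t : R) (p q : R -> R) : cos_polys p -> cos_polys q ->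
  cos_polys (fun x => t * p x + q x) /\
  cos_coef (fun x => t * p x + q x) = (fun k => t * cos_coef p k + cos_coef q k).
Proof.
move=> /cos_polys_cos_coef[n pn] /cos_polys_cos_coef[m qm].
set a := cos_coef p in pn *; set b := cos_coef q in qm *.
have E N : (maxn n m <= N)%N ->
    (fun x => t * p x + q x) = cos_poly R N (fun k => t * a k + b k).
  rewrite geq_max => /andP[nN mN]; apply/funext => x.
  rewrite (pn _ nN) (qm _ mN) /cos_poly mulr_sumr -big_split/=.
  by apply: eq_bigr => k _; ring.
split; first by exists (maxn n m), (fun k => t * a k + b k); exact: E.
apply/funext => k; rewrite (E (maxn (maxn n m) k.+1)) ?leq_maxl// cos_coef_poly.
by rewrite leq_max ltnSn orbT.
Qed.

Lemma cos_polys_bounded (p : R -> R) : cos_polys p -> exists B, forall x, `|p x| <= B.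
Proof.
move=> [n [c ->]]; exists (\sum_(k < n) `|c k| * 2) => x.
apply: le_trans (ler_norm_sum _ _ _) _; apply: ler_sum => k _.
by rewrite normrM ler_wpM2l// cos_basis_bounded.
Qed.

Lemma L2_of_cos_polys (p : R -> R) : cos_polys p ->
  exists2 f : L2 R, (f : R -> R) = p %[ae mu] & cos_coef f = cos_coef p.
Proof.
move=> Pp; have [B pB] := cos_polys_bounded p Pp.
have mp : measurable_fun setT (p : measurableTypeR R -> measurableTypeR R).
  case: Pp => n [c ->]; apply: continuous_measurable_fun.
  exact: (continuous_cos_poly R n c).
have [f fp fk] := L2_of_bounded R p B mp pB.
by exists f => //; apply/funext.
Qed.

End cosine_polynomial_space.

Section weighted_coefficients.
Variable R : realType.

Lemma sqsum_le_scale (u v : nat -> R) (C : R) n : 0 <= C ->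
  (forall k, `|u k| <= C * `|v k|) -> Num.sqrt (sqsum R u n) <= C * Num.sqrt (sqsum R v n).
Proof.
move=> C0 uv; have -> : C = Num.sqrt (C ^+ 2) by rewrite sqrtr_sqr ger0_norm.
rewrite -sqrtrM ?sqr_ge0// ler_wsqrtr// /sqsum mulr_sumr; apply: ler_sum => k _.
rewrite -exprMn -[leLHS]real_normK ?num_real// -[leRHS]real_normK ?num_real//.
by rewrite ler_sqr ?nnegrE// normrM (ger0_norm C0).
Qed.

Lemma ell2_norm_le_scale (a b : ell2 R) (C : R) : 0 <= C ->
  (forall k, `|val a k| <= C * `|val b k|) -> `|a| <= C * `|b|.
Proof.
move=> C0 ab; apply: ell2_norm_le => n; apply: le_trans (sqsum_le_scale _ _ _ n C0 ab) _.
by rewrite ler_wpM2l// ell2_norm_ub.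
Qed.

Lemma sqsummable_le_scale (u v : nat -> R) (C : R) : 0 <= C ->
  (forall k, `|u k| <= C * `|v k|) -> v \in sqsummable R -> u \in sqsummable R.
Proof.
move=> C0 uv /sqsummableP[B vB]; apply/sqsummableP; exists (C * B) => n.
by apply: le_trans (sqsum_le_scale _ _ _ n C0 uv) _; rewrite ler_wpM2l.
Qed.

Lemma sqsummable_finite (u : nat -> R) n : (forall k, (n <= k)%N -> u k = 0) ->
  u \in sqsummable R.
Proof.
move=> u0; rewrite (_ : u = truncate R n u) ?truncate_sqsummable//.
by apply/funext => k; rewrite /truncate; case: ltnP => // /u0.
Qed.

Variables (alpha gamma : R).
Hypotheses (halpha : 1 < alpha < 2) (gamma_gt0 : 0 < gamma).
Variables (m M : R).
Hypotheses (m_gt0 : 0 < m)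
  (mM : forall k, (0 < k)%N ->
    m * k%:R `^ alpha <= Num.sqrt (sob_eigen R alpha k) <= M * k%:R `^ alpha).

Definition sob_weight (k : nat) : R :=
  if k == 0%N then 1 else gamma^-1 * Num.sqrt (sob_eigen R alpha k).

Definition sob_seq (f : R -> R) (k : nat) : R := sob_weight k * cos_coef f k.

Let c : R := Num.min 1 m.
Let C : R := Num.max 1 M.

Let c_gt0 : 0 < c. Proof. by rewrite /c lt_min ltr01. Qed.
Let C_gt0 : 0 < C. Proof. by rewrite /C lt_max ltr01. Qed.

(** The factor gamma^-1 cancels for k > 0, leaving m and M; the weights at k = 0 are both 1, whence
    the 1 in the minimum and the maximum. *)
Lemma weight_bounds k :
  c * cosine_weight R alpha gamma k <= sob_weight k <= C * cosine_weight R alpha gamma k.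
Proof.
rewrite /cosine_weight /sob_weight; case: eqP => [_|/eqP k0].
  by rewrite !mulr1 /c /C ge_min le_max !lexx.
have kk : (0 < k)%N by rewrite lt0n.
have /andP[h1 h2] := mM k kk.
rewrite ![_ * (gamma^-1 * _)]mulrCA !ler_pM2l ?invr_gt0//; apply/andP; split.
  by apply: le_trans h1; rewrite ler_wpM2r ?powR_ge0// /c ge_min lexx orbT.
by apply: le_trans h2 _; rewrite ler_wpM2r ?powR_ge0// /C le_max lexx orbT.
Qed.

Lemma cosine_weight_gt0 k : 0 < cosine_weight R alpha gamma k.
Proof.
rewrite /cosine_weight; case: eqP => // /eqP k0.
by rewrite mulr_gt0 ?invr_gt0// powR_gt0// ltr0n lt0n.
Qed.

Lemma sob_weight_gt0 k : 0 < sob_weight k.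
Proof.
have /andP[h _] := weight_bounds k.
exact: lt_le_trans (mulr_gt0 c_gt0 (cosine_weight_gt0 k)) h.
Qed.

Lemma sob_seq_le f k : `|sob_seq f k| <= C * `|cosine_seq R alpha gamma f k|.
Proof.
rewrite !normrM mulrA ler_wpM2r// !gtr0_norm ?cosine_weight_gt0 ?sob_weight_gt0//.
by case/andP: (weight_bounds k).
Qed.

Lemma cosine_seq_le f k : `|cosine_seq R alpha gamma f k| <= c^-1 * `|sob_seq f k|.
Proof.
rewrite !normrM mulrA ler_wpM2r// !gtr0_norm ?cosine_weight_gt0 ?sob_weight_gt0//.
by rewrite ler_pdivlMl//; case/andP: (weight_bounds k).
Qed.

Lemma sob_seq_cos_polys p : cos_polys p -> sob_seq p \in sqsummable R.
Proof.
move=> [n [a ->]]; apply: (sqsummable_finite _ n) => k nk.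
by rewrite /sob_seq (cos_coef_poly R n a) ltnNge nk mulr0.
Qed.

(* The value is [0] if the weighted coefficients are not square-summable. *)
Definition sob_ell2 (f : R -> R) : ell2 R := insubd (0 : ell2 R) (sob_seq f).

Lemma val_sob_ell2 f : sob_seq f \in sqsummable R -> val (sob_ell2 f) = sob_seq f.
Proof. by move=> fs; rewrite /sob_ell2 val_insubd fs. Qed.

(** Read off from the lower bound on the square root: a negative eigenvalue would have square root
    0, below m k^alpha > 0. *)
Lemma sob_eigen_ge0 k : 0 <= sob_eigen R alpha k.
Proof.
case: k => [|k]; first by rewrite /sob_eigen !mul0r expr0n/= mul0r.
rewrite leNgt; apply/negP => neg.
have /andP[+ _] := mM k.+1 isT; rewrite (ltr0_sqrtr neg) leNgt.
by rewrite mulr_gt0 ?powR_gt0.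
Qed.

Lemma sob_inner_sqsum n (a : nat -> R) :
  sob_inner alpha gamma (cos_poly R n a) (cos_poly R n a) =
  sqsum R (fun k => sob_weight k * a k) n.
Proof.
rewrite sob_inner_cos_poly//; elim: n => [|n IH].
  by rewrite /sqsum !big_ord0 mulr0 expr0n addr0.
rewrite /sqsum !big_ord_recr/= -/(sqsum R (fun k => sob_weight k * a k) n) -IH.
rewrite [sob_weight n]/sob_weight; case: n {IH} => [|n]/=.
  by rewrite !big_ord0 /sob_eigen mul0r expr0n/= !mul0r mul1r; ring.
rewrite !exprMn sqr_sqrtr ?sob_eigen_ge0// exprVn; ring.
Qed.

(** The weighted partial sums are constant from the length of p on, so the supremum is attained
    there. *)
Lemma sob_norm_ell2 p : cos_polys p -> sob_norm alpha gamma p = `|sob_ell2 p|.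
Proof.
move=> Pp; have vE := val_sob_ell2 p (sob_seq_cos_polys p Pp).
have [n pn] := cos_polys_cos_coef R p Pp.
have E N : (n <= N)%N -> sob_norm alpha gamma p = Num.sqrt (sqsum R (sob_seq p) N).
  by move=> nN; rewrite /sob_norm {1 2}(pn N nN) sob_inner_sqsum.
apply/eqP; rewrite eq_le; apply/andP; split.
  by rewrite (E n)// -vE; exact: ell2_norm_ub.
apply: ell2_norm_le => N; rewrite vE (E (maxn n N)) ?leq_maxl//.
by rewrite ler_wsqrtr// sqsum_le// leq_maxr.
Qed.

Lemma sob_ell2_lin t p q : cos_polys p -> cos_polys q ->
  sob_ell2 (fun x => t * p x + q x) = t *: sob_ell2 p + sob_ell2 q.
Proof.
move=> Pp Pq; have [Ppq cE] := cos_polys_lin R t p q Pp Pq.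
apply: val_inj; rewrite val_sob_ell2 ?sob_seq_cos_polys//.
rewrite [RHS](_ : _ = t *: val (sob_ell2 p) + val (sob_ell2 q))//.
rewrite !val_sob_ell2 ?sob_seq_cos_polys//; apply/funext => k.
rewrite [RHS](_ : _ = t * sob_seq p k + sob_seq q k)// /sob_seq cE; ring.
Qed.

Lemma truncate_cos_poly f n : sob_seq f \in sqsummable R ->
  ell2_truncate R n (sob_ell2 f) = sob_ell2 (cos_poly R n (cos_coef f)).
Proof.
move=> fs; apply: val_inj; rewrite val_sob_ell2; last first.
  by apply: sob_seq_cos_polys; exists n, (cos_coef f).
rewrite /= val_sob_ell2//; apply/funext => k; rewrite /truncate /sob_seq cos_coef_poly.
by case: ifP => // _; rewrite mulr0.
Qed.

(** The quotients b_k / w_k of the entries by the weights are absolutely summable because |b_k| /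
    w_k <= b_k^2 + w_k^-2 and w_k >= q k, the latter from k^alpha >= k; the sum of their cosine
    series is the preimage. *)
Lemma sob_ell2_surj (b : ell2 R) :
  exists2 f : L2 R, sob_seq f = val b & (f \in cosine_space_pred alpha gamma).
Proof.
pose a k := val b k / sob_weight k.
have [f fa] : exists f : L2 R, forall k, cos_coef f k = a k.
  pose q : R := c * gamma^-1.
  have q0 : 0 < q by rewrite mulr_gt0 ?invr_gt0.
  apply: (cos_series R a (`|b| ^+ 2 + (1 + q ^- 2 * 2))) => n.
  (* The indicator of k = 0 accounts for w_0 = 1, since 0^-2 evaluates to 0. *)
  have le1 k : `|a k| <= val b k ^+ 2 + ((k == 0%N)%:R + q ^- 2 * k%:R ^- 2).
    have wk : (sob_weight k)^-1 ^+ 2 <= (k == 0%N)%:R + q ^- 2 * k%:R ^- 2.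
      case: k => [|k]/=; first by rewrite /sob_weight/= invr1 expr1n expr0n invr0 mulr0 addr0.
      have qk : 0 < q * k.+1%:R := mulr_gt0 q0 (ltr0Sn _ _).
      rewrite add0r -invfM -exprMn exprVn lef_pV2 ?posrE ?exprn_gt0 ?sob_weight_gt0//.
      rewrite ler_sqr ?nnegrE ?(ltW qk) ?(ltW (sob_weight_gt0 _))//.
      have /andP[h _] := weight_bounds k.+1; apply: le_trans h.
      rewrite /q -mulrA ler_wpM2l ?(ltW c_gt0)// /cosine_weight/=
        ler_wpM2l ?invr_ge0 ?(ltW gamma_gt0)//.
      by apply: le1r_powR; rewrite ?ler1n//; case/andP: halpha => /ltW.
    have ab : `|a k| = `|val b k| * (sob_weight k)^-1.
      by rewrite normrM normfV (gtr0_norm (sob_weight_gt0 k)).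
    rewrite ab; apply: le_trans (lerD (lexx _) wk).
    rewrite -[val b k ^+ 2]real_normK ?num_real//.
    move: `|val b k| (normr_ge0 (val b k)) ((sob_weight k)^-1) => x x0 y.
    by have := sqr_ge0 (x - y); have := sqr_ge0 (x + y); nra.
  apply: (@le_trans _ _ (\sum_(k < n) (val b k ^+ 2 +
      ((k == 0%N :> nat)%:R + q ^- 2 * k%:R ^- 2)))).
    by apply: ler_sum => k _; exact: le1.
  rewrite !big_split/=; apply: lerD.
    rewrite -/(sqsum R (val b) n) -[leLHS]sqr_sqrtr ?sqsum_ge0//.
    by rewrite ler_sqr ?nnegrE ?sqrtr_ge0//; exact: ell2_norm_ub.
  apply: lerD.
    case: n => [|n]; first by rewrite big_ord0.
    rewrite big_ord_recl/= big1 ?addr0// => k _.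
  by rewrite -mulr_sumr ler_wpM2l ?invr_ge0 ?sqr_ge0// sum_inv_sqr_le.
have fb : sob_seq f = val b.
  by apply/funext => k; rewrite /sob_seq fa /a mulrC divfK// gt_eqF// sob_weight_gt0.
exists f => //; apply: cosine_space_predP.
apply: (sqsummable_le_scale _ _ c^-1 _ (cosine_seq_le f)).
  by rewrite invr_ge0 ltW.
by rewrite fb; exact: valP.
Qed.

(** For density, each point of [ell2] comes from some f, and its truncations are the images of the
    partial sums of the cosine series of f. *)
Lemma sob_ell2_completion :
  is_completion (@cos_polys R) (sob_norm alpha gamma) sob_ell2.
Proof.
split; first exact: sob_ell2_lin.
  by move=> p Pp; rewrite sob_norm_ell2.
move=> O [x Ox] oO.
have /nbhs_ballP[e /= e0 xO] : nbhs x O by exact: open_nbhs_nbhs.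
have [n hn] := ell2_truncate_near R x (e / 2) (divr_gt0 e0 (ltr0Sn R 1)).
have [f fx _] := sob_ell2_surj x.
have fs : sob_seq f \in sqsummable R by rewrite fx; exact: valP.
have xE : x = sob_ell2 f by apply: val_inj; rewrite val_sob_ell2.
exists (ell2_truncate R n x); split.
  apply: xO; rewrite -ball_normE/=; apply: le_lt_trans (hn n (leqnn n)) _.
  by rewrite ltr_pdivrMr// ltr_pMr// ltr1n.
by rewrite xE truncate_cos_poly//; exists (cos_poly R n (cos_coef f)) => //; exists n, (cos_coef f).
Qed.

Local Notation H := (cosine_space alpha gamma).

Lemma sob_seq_space (f : H) : sob_seq f \in sqsummable R.
Proof.
apply: (sqsummable_le_scale _ _ C (ltW C_gt0) (sob_seq_le f)).
exact: cosine_seq_sqsummable.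
Qed.

Lemma sob_ell2_norm_bounds (f : H) :
  c * cosine_norm alpha gamma f <= `|sob_ell2 f| <= C * cosine_norm alpha gamma f.
Proof.
pose a := Ell2 R _ (cosine_seq_sqsummable R alpha gamma f).
rewrite (cosine_normE _ _ _ a f erefl); apply/andP; split.
  rewrite -ler_pdivlMl//; apply: ell2_norm_le_scale => [|k].
    by rewrite invr_ge0 ltW.
  by rewrite val_sob_ell2 ?sob_seq_space//; exact: cosine_seq_le.
apply: ell2_norm_le_scale => [|k]; first exact: ltW.
by rewrite val_sob_ell2 ?sob_seq_space//; exact: sob_seq_le.
Qed.

Lemma sob_ell2_linear : linear (fun f : H => sob_ell2 f).
Proof.
move=> t f g; apply: val_inj; rewrite val_sob_ell2 ?sob_seq_space//.
rewrite [RHS](_ : _ = t *: val (sob_ell2 f) + val (sob_ell2 g))//.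
rewrite !val_sob_ell2 ?sob_seq_space//; apply/funext => k.
rewrite [RHS](_ : _ = t * sob_seq f k + sob_seq g k)// /sob_seq.
by rewrite [cos_coef _ _](cos_coef_linear t (val f) (val g)); ring.
Qed.

Lemma sob_ell2_inj (f g : H) : sob_ell2 f = sob_ell2 g -> f = g.
Proof.
move=> fg; apply/eqP; rewrite -subr_eq0; apply/eqP; apply: val_inj.
apply: cos_coef_eq0 => k.
have := congr1 (fun a : ell2 R => val a k) fg.
rewrite !val_sob_ell2 ?sob_seq_space// /sob_seq => /(mulfI (lt0r_neq0 (sob_weight_gt0 k))) E.
rewrite (_ : val (f - g) = (-1) *: val g + val f); last first.
  by rewrite scaleN1r addrC.
by rewrite cos_coef_linear mulN1r addrC; apply/eqP; rewrite subr_eq0; apply/eqP.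
Qed.

Lemma sob_ell2_bij : exists S : ell2 R -> H, cancel (fun f : H => sob_ell2 f) S /\
  cancel S (fun f : H => sob_ell2 f).
Proof.
have ex (b : ell2 R) : exists f : H, sob_ell2 f = b.
  have [f fb fH] := sob_ell2_surj b; exists (CosineSpace fH).
  by apply: val_inj; rewrite val_sob_ell2 ?sob_seq_space.
have [S SP] := choice ex.
by exists S; split=> [f|b]; [apply: sob_ell2_inj|]; rewrite SP.
Qed.

Lemma cos_polys_in_space p : cos_polys p ->
  exists2 f : H, (f : R -> R) = p %[ae unit_measure R] & sob_ell2 f = sob_ell2 p.
Proof.
move=> Pp; have [f fp fE] := L2_of_cos_polys R p Pp.
have fs : sob_seq f = sob_seq p by apply/funext => k; rewrite /sob_seq fE.
have fH : f \in cosine_space_pred alpha gamma.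
  apply: cosine_space_predP; apply: (sqsummable_le_scale _ _ c^-1 _ (cosine_seq_le f)).
    by rewrite invr_ge0 ltW.
  by rewrite fs; exact: sob_seq_cos_polys.
exists (CosineSpace fH) => //; apply: val_inj; rewrite val_sob_ell2 ?sob_seq_space//.
by rewrite val_sob_ell2 ?sob_seq_cos_polys.
Qed.

Lemma cosine_space_approx (f : H) e : 0 < e -> exists p (g : H),
  [/\ cos_polys p, (g : R -> R) = p %[ae unit_measure R] &
      cosine_norm alpha gamma (f - g : H) <= e].
Proof.
(* The accuracy c e compensates the factor c in the lower norm bound that brings the estimate back
   from [ell2]. *)
move=> e0; have [n hn] := ell2_truncate_near R (sob_ell2 f) (c * e) (mulr_gt0 c_gt0 e0).
have Pp : cos_polys (cos_poly R n (cos_coef f)) by exists n, (cos_coef f).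
have [g gp gE] := cos_polys_in_space _ Pp.
exists (cos_poly R n (cos_coef f)), g; split=> //.
rewrite -(ler_pM2l c_gt0); have /andP[h _] := sob_ell2_norm_bounds (f - g).
apply: le_trans h _.
have -> : sob_ell2 (f - g : H) = sob_ell2 f - sob_ell2 g.
  by have := sob_ell2_linear (-1) g f; rewrite /= !scaleN1r ![- _ + _]addrC => ->.
by rewrite gE -truncate_cos_poly ?sob_seq_space//; exact: hn.
Qed.

Section isomorphism.
Variables (E : completeNormedModType R) (j : (R -> R) -> E).
Hypothesis Ej : is_completion (@cos_polys R) (sob_norm alpha gamma) j.

(** Both maps are bounded and agree on the polynomials, which are dense in the cosine space. *)
Lemma isomorphism_unique (T T' : H -> E) :
  is_isomorphism T -> extends_identity j T ->
  is_isomorphism T' -> extends_identity j T' -> T = T'.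
Proof.
move=> [Tlin [_ [_ _ [B TB] _]]] Tj [T'lin [_ [_ _ [B' TB'] _]]] T'j.
have norm0 (f : H) : 0 <= cosine_norm alpha gamma f by exact: sqrtr_ge0.
apply/funext => f; apply/eqP; rewrite -subr_eq0 -normr_le0.
apply/ler_addgt0Pr => e e0; rewrite add0r.
(* The bounds B and B' need not be nonnegative, hence the absolute values; the + 1 makes the divisor
   positive. *)
have K0 : 0 < `|B| + `|B'| + 1 by rewrite ltr_wpDl// addr_ge0.
have [p [g [Pp gp fg]]] := cosine_space_approx f _ (divr_gt0 e0 K0).
(* The preimages of j p under T and T' might differ a priori; both are almost everywhere equal to p,
   so they are one class. *)
have same (h : H) : (h : R -> R) = p %[ae unit_measure R] -> h = g.
  move=> hp; apply: val_inj; apply/L2_eqP.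
  by apply: ae_eq_trans hp _; exact: ae_eq_sym.
have Tg : T g = T' g.
  have [h /same -> ->] := Tj p Pp; by have [h' /same -> ->] := T'j p Pp.
have sub (U : H -> E) : linear U -> U (f - g) = U f - U g.
  by move=> Ul; have := Ul (-1) g f; rewrite !scaleN1r ![- _ + _]addrC.
have -> : T f - T' f = T (f - g) - T' (f - g).
  by rewrite !sub// Tg opprB addrA subrK.
apply: le_trans (ler_normB _ _) _.
apply: le_trans (lerD (TB _) (TB' _)) _; rewrite -mulrDl.
rewrite ler_pdivlMr// mulrC in fg; apply: le_trans fg.
by rewrite ler_wpM2r// -addrA lerD ?ler_norm// ler_wpDr// ler_norm.
Qed.

(** The map is [sob_ell2] followed by the isometry of [ell2] onto E. The norm equality is kept so
    that the bounds of [sob_ell2_norm_bounds] carry over with their constants. *)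
Lemma isomorphism_exists : exists T : H -> E,
  [/\ is_isomorphism T, extends_identity j T &
    forall f : H, `|T f| = `|sob_ell2 f|].
Proof.
have lin t p q : cos_polys p -> cos_polys q -> cos_polys (fun x : R => t * p x + q x).
  by move=> Pp Pq; have [] := cos_polys_lin R t p q Pp Pq.
have [V [W [Vlin VW WV Vnorm Vj]]] :=
  completion_unique R _ _ lin _ _ _ _ sob_ell2_completion Ej.
have [S [TS ST]] := sob_ell2_bij.
exists (fun f => V (sob_ell2 f)); split.
- split; first by move=> t f g; rewrite sob_ell2_linear Vlin.
  exists (S \o W); split.
  + by move=> f; rewrite /= VW TS.
  + by move=> e; rewrite /= ST WV.
  + by exists C => f; rewrite Vnorm; case/andP: (sob_ell2_norm_bounds f).
  + exists c^-1 => e; rewrite ler_pdivlMl//.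
    have /andP[h _] := sob_ell2_norm_bounds (S (W e)); apply: le_trans h _.
    by rewrite ST -Vnorm WV.
- move=> p Pp; have [f fp fE] := cos_polys_in_space p Pp.
  by exists f => //; rewrite fE Vj.
- by move=> f; rewrite Vnorm.
Qed.

End isomorphism.

End weighted_coefficients.

Theorem theorem3p3 (R : realType) (alpha : R) (halpha : 1 < alpha < 2) :
  exists c C : R, [/\ 0 < c, c <= C &
    forall gamma : R, 0 < gamma ->
      (exists (E : completeNormedModType R) (j : (R -> R) -> E),
          is_completion (@cos_polys R) (sob_norm alpha gamma) j) /\
      (forall (E : completeNormedModType R) (j : (R -> R) -> E),
          is_completion (@cos_polys R) (sob_norm alpha gamma) j ->
          exists T : cosine_space alpha gamma -> E,
            unique (fun T' => is_isomorphism T' /\ extends_identity j T') T /\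
            forall f : cosine_space alpha gamma,
              c * cosine_norm alpha gamma f <= `|T f| <= C * cosine_norm alpha gamma f)].
Proof.
have [m [M [m0 mM key]]] := sob_eigen_bounds R alpha halpha.
(* The eigenvalues do not involve gamma, so the constants can be fixed before it. *)
exists (Num.min 1 m), (Num.max 1 M); split.
- by rewrite lt_min ltr01.
- by rewrite ge_min !le_max lexx.
move=> gamma g0; split.
  exists (ell2 R), (sob_ell2 R alpha gamma).
  exact: sob_ell2_completion halpha g0 m M m0 key.
move=> E j Ej.
have [T [Tiso Tj Tn]] := isomorphism_exists R alpha gamma halpha g0 m M m0 key E j Ej.
exists T; split.
  split=> // T' [T'iso T'j].
  exact: (isomorphism_unique R alpha gamma g0 m M m0 key E j T T' Tiso Tj T'iso T'j).
by move=> f; rewrite Tn; exact: (sob_ell2_norm_bounds R alpha gamma g0 m M m0 key).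
Qed.
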